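(* Let $R$ be a commutative Noetherian henselian local ring and let $\mathcal C$ be a subcategory of $\mathrm{mod}\,R$ which satisfies the following conditions: (1) $\mathcal C$ is a resolving subcategory of $\mathrm{mod}\,R$; (2) $\mathcal C\subseteq\mathcal H$; (3) $\mathcal C$ is of finite type. Then $\mathrm{mod}\,\underline{\mathcal C}$ is a Frobenius category and $\mathcal C\subseteq\mathcal G$.
   Context: $\mathrm{mod}\,R$ is the category of finitely generated $R$-modules. A *subcategory* of $\mathrm{mod}\,R$ always means a full subcategory closed under isomorphism, such that for all $X,Y\in\mathrm{mod}\,R$ one has $X\oplus Y\in\mathcal C$ if and only if $X\in\mathcal C$ and $Y\in\mathcal C$, and which contains all projective modules in $\mathrm{mod}\,R$. $\mathcal C$ is *resolving* if for every exact sequence $0\to X\to Y\to Z\to 0$ in $\mathrm{mod}\,R$: $X,Z\in\mathcal C$ implies $Y\in\mathcal C$, and $Y,Z\in\mathcal C$ implies $X\in\mathcal C$. An additive category is *of finite type* if it has only finitely many isomorphism classes of indecomposable objects. The transpose $\mathrm{Tr}\,X$ of $X\in\mathrm{mod}\,R$ is the cokernel of $\mathrm{Hom}_R(P_0,R)\to\mathrm{Hom}_R(P_1,R)$, where $P_1\to P_0\to X\to 0$ is a presentation by finitely generated projective modules (unique up to projective summands). $\mathcal H$ is the subcategory of all $X\in\mathrm{mod}\,R$ with $\mathrm{Ext}^i_R(X,R)=0$ for all $i>0$. $\mathcal G$ is the subcategory of all $X\in\mathrm{mod}\,R$ with $\mathrm{Ext}^i_R(X,R)=0$ and $\mathrm{Ext}^i_R(\mathrm{Tr}\,X,R)=0$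 for all $i>0$. The stable category $\underline{\mathcal C}$ has the same objects as $\mathcal C$, and its morphism sets are $\underline{\mathrm{Hom}}_R(X,Y)=\mathrm{Hom}_R(X,Y)/P(X,Y)$, where $P(X,Y)$ is the submodule of homomorphisms that factor through projective modules. $\mathrm{mod}\,\underline{\mathcal C}$ is the category of finitely presented contravariant additive functors $F$ from $\underline{\mathcal C}$ to abelian groups, with natural transformations as morphisms; finitely presented means that there is an exact sequence $\underline{\mathrm{Hom}}_R(-,X_1)|_{\underline{\mathcal C}}\to\underline{\mathrm{Hom}}_R(-,X_0)|_{\underline{\mathcal C}}\to F\to 0$ with $X_0,X_1\in\mathcal C$. A category is *Frobenius* if it is an abelian category with enough projectives and enough injectives, all projective objects are injective, and all injective objects are projective. *)

(* Defs.v *)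
From HB Require Import structures.
From mathcomp Require Import all_boot all_algebra.
From mathcomp Require Import boolp classical_sets.

Set Implicit Arguments.
Unset Strict Implicit.
Unset Printing Implicit Defensive.

Import GRing.Theory.
Local Open Scope ring_scope.
Local Open Scope quotient_scope.

Section Rings.
Variable R : comNzRingType.

Definition is_ideal (I : set R) : Prop :=
  I 0 /\ forall a x y, I x -> I y -> I (a * x + y).

Definition noetherian : Prop :=
  forall I : set R, is_ideal I ->
    exists (n : nat) (g : 'I_n -> R), forall x,
      I x <-> exists c : 'I_n -> R, x = \sum_(i < n) c i * g i.

Definition maximal_ideal (m : set R) : Prop :=
  [/\ is_ideal m, m <> setT &
      forall I : set R, is_ideal I -> (m `<=` I)%classic -> I = m \/ I = setT].

Definition local_ring : Prop := exists! m : set R, maximal_ideal m.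

(* Hensel's lemma: coprime monic factorizations over the residue field lift.
   When R is local, the kernel of a surjective ring morphism pi from R to a
   field is the maximal ideal, so k ranges over the copies of the residue
   field. *)
Definition henselian : Prop :=
  forall (k : fieldType) (pi : {rmorphism R -> k}),
    (forall z, exists x, pi x = z) ->
  forall (f : {poly R}) (g0 h0 : {poly k}),
    f \is monic -> g0 \is monic -> h0 \is monic -> coprimep g0 h0 ->
    map_poly pi f = g0 * h0 ->
  exists g h : {poly R},
    [/\ g \is monic, h \is monic, map_poly pi g = g0, map_poly pi h = h0
      & f = g * h].

Definition henselian_local_ring : Prop := local_ring /\ henselian.

End Rings.

Lemma additive_ext (U V : zmodType) (f g : {additive U -> V}) :
  f =1 g -> f = g.
Proof.
case: f => f [[hf]]; case: g => g [[hg]] /= /funext e.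
by move: hf; rewrite e => hf; rewrite (Prop_irrelevance hf hg).
Qed.

Lemma linear_ext (R : pzRingType) (U V : lmodType R) (f g : {linear U -> V}) :
  f =1 g -> f = g.
Proof.
case: f => f [[hf] [sf]]; case: g => g [[hg] [sg]] /= /funext e.
move: hf sf; rewrite e => hf sf.
by rewrite (Prop_irrelevance hf hg) (Prop_irrelevance sf sg).
Qed.

Section HomModule.
Variables (R : comNzRingType) (U V : lmodType R).
Implicit Types f g h : {linear U -> V}.

HB.instance Definition _ := gen_eqMixin {linear U -> V}.
HB.instance Definition _ := gen_choiceMixin {linear U -> V}.

Definition hom_zero : {linear U -> V} := \0.
Definition hom_opp f : {linear U -> V} := \- f.
Definition hom_add f g : {linear U -> V} := f \+ g.
Definition hom_scale (a : R) f : {linear U -> V} := a \*: f.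

Fact hom_addA : associative hom_add.
Proof. by move=> f g h; apply: linear_ext => x /=; rewrite addrA. Qed.
Fact hom_addC : commutative hom_add.
Proof. by move=> f g; apply: linear_ext => x /=; rewrite addrC. Qed.
Fact hom_add0 : left_id hom_zero hom_add.
Proof. by move=> f; apply: linear_ext => x /=; rewrite add0r. Qed.
Fact hom_addN : left_inverse hom_zero hom_opp hom_add.
Proof. by move=> f; apply: linear_ext => x /=; rewrite addNr. Qed.

HB.instance Definition _ := GRing.isZmodule.Build {linear U -> V}
  hom_addA hom_addC hom_add0 hom_addN.

Fact hom_scaleA a b f : hom_scale a (hom_scale b f) = hom_scale (a * b) f.
Proof. by apply: linear_ext => x /=; rewrite scalerA. Qed.
Fact hom_scale1 : left_id 1 hom_scale.
Proof. by move=> f; apply: linear_ext => x /=; rewrite scale1r. Qed.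
Fact hom_scaleDr : right_distributive hom_scale +%R.
Proof. by move=> a f g; apply: linear_ext => x /=; rewrite scalerDr. Qed.
Fact hom_scaleDl f : {morph hom_scale^~ f : a b / a + b}.
Proof. by move=> a b; apply: linear_ext => x /=; rewrite scalerDl. Qed.

HB.instance Definition _ := GRing.Zmodule_isLmodule.Build R {linear U -> V}
  hom_scaleA hom_scale1 hom_scaleDr hom_scaleDl.

Lemma hom_addE f g x : (f + g : {linear U -> V}) x = f x + g x.
Proof. by []. Qed.
Lemma hom_scaleE a f x : (a *: f : {linear U -> V}) x = a *: f x.
Proof. by []. Qed.

End HomModule.

Section LmodQuotient.
Variables (R : nzRingType) (V : lmodType R) (I : {pred V}).
Hypothesis I_submod : submod_closed I.

Definition submod_pred of submod_closed I : {pred V} := I.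
Local Notation S := (submod_pred I_submod).

Fact submod_pred_zmod_closed : zmod_closed S.
Proof.
split=> [|x y xS yS]; first exact: I_submod.1.
by rewrite addrC -scaleN1r; apply: I_submod.2.
Qed.
HB.instance Definition _ := GRing.isZmodClosed.Build V S submod_pred_zmod_closed.

Definition lmod_quot := Quotient.quot S.
HB.instance Definition _ := GRing.Zmodule.on lmod_quot.

Definition lmod_pi (x : V) : lmod_quot := \pi_(Quotient.quot S) x.

Lemma lmod_pi_eq x y : lmod_pi x = lmod_pi y <-> x - y \in I.
Proof.
rewrite -[_ \in I]/(_ \in S) Quotient.idealrBE.
by split=> [e|/eqP//]; apply/eqP.
Qed.

Lemma lmod_pi_surj (z : lmod_quot) : exists x, lmod_pi x = z.
Proof. by exists (repr z); rewrite /lmod_pi reprK. Qed.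

Lemma lmod_piD x y : lmod_pi (x + y) = lmod_pi x + lmod_pi y.
Proof. exact: pi_addr. Qed.

Definition lmod_quot_scale (a : R) (z : lmod_quot) : lmod_quot :=
  lmod_pi (a *: repr z).

Lemma lmod_quot_scaleE a x : lmod_quot_scale a (lmod_pi x) = lmod_pi (a *: x).
Proof.
apply/lmod_pi_eq; rewrite -scalerBr -[_ *: _]addr0.
apply: I_submod.2; last exact: I_submod.1.
by apply/lmod_pi_eq; rewrite /lmod_pi reprK.
Qed.

Fact lmod_quot_scaleA a b z :
  lmod_quot_scale a (lmod_quot_scale b z) = lmod_quot_scale (a * b) z.
Proof.
by case: (lmod_pi_surj z) => x <-; rewrite !lmod_quot_scaleE scalerA.
Qed.
Fact lmod_quot_scale1 : left_id 1 lmod_quot_scale.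
Proof.
by move=> z; case: (lmod_pi_surj z) => x <-; rewrite lmod_quot_scaleE scale1r.
Qed.
Fact lmod_quot_scaleDr : right_distributive lmod_quot_scale +%R.
Proof.
move=> a z t; case: (lmod_pi_surj z) (lmod_pi_surj t) => x <- [y <-].
by rewrite -lmod_piD !lmod_quot_scaleE scalerDr lmod_piD.
Qed.
Fact lmod_quot_scaleDl z : {morph lmod_quot_scale^~ z : a b / a + b}.
Proof.
move=> a b; case: (lmod_pi_surj z) => x <-.
by rewrite !lmod_quot_scaleE scalerDl lmod_piD.
Qed.

HB.instance Definition _ := GRing.Zmodule_isLmodule.Build R lmod_quot
  lmod_quot_scaleA lmod_quot_scale1 lmod_quot_scaleDr lmod_quot_scaleDl.

End LmodQuotient.

Section Modules.
Variable R : comNzRingType.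
Implicit Types X Y Z P M N : lmodType R.

Definition fin_gen M : Prop :=
  exists (n : nat) (g : 'I_n -> M),
    forall x, exists c : 'I_n -> R, x = \sum_(i < n) c i *: g i.

Definition surjective (A B : Type) (f : A -> B) : Prop :=
  forall y, exists x, f x = y.

Definition exact_at X Y Z (f : {linear X -> Y}) (g : {linear Y -> Z}) : Prop :=
  forall y, g y = 0 <-> exists x, f x = y.

Definition short_exact X Y Z (f : {linear X -> Y}) (g : {linear Y -> Z}) :=
  [/\ injective f, exact_at f g & surjective g].

Definition iso_mod X Y : Prop := exists f : {linear X -> Y}, bijective f.

Definition projective P : Prop :=
  forall M N (p : {linear M -> N}) (f : {linear P -> N}), surjective p ->
    exists g : {linear P -> M}, forall x, p (g x) = f x.

Record proj_resolution X := ProjResolution {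
  res_obj : nat -> lmodType R;
  res_d : forall i, {linear res_obj i.+1 -> res_obj i};
  res_aug : {linear res_obj 0%N -> X};
  res_projective : forall i, projective (res_obj i);
  res_exact : forall i, exact_at (res_d i.+1) (res_d i);
  res_exact0 : exact_at (res_d 0%N) res_aug;
  res_aug_surj : surjective res_aug }.

Section Ext.
Variables (X N : lmodType R) (P : proj_resolution X).

Definition cocycle i (f : {linear res_obj P i -> N}) : Prop :=
  forall x, f (res_d P i x) = 0.

Definition coboundary i : {linear res_obj P i -> N} -> Prop :=
  match i with
  | 0%N => fun f => forall x, f x = 0
  | j.+1 => fun f => exists g : {linear res_obj P j -> N},
                       forall x, f x = g (res_d P j x)
  end.

End Ext.

(* Ext^i(X, N) = 0: the cochain complex Hom(P, N) has no cohomology in degree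
   i; the condition does not depend on the projective resolution P of X. *)
Definition ext_vanishes i X N : Prop :=
  forall (P : proj_resolution X) (f : {linear res_obj P i -> N}),
    cocycle f -> coboundary f.

Record proj_presentation X := ProjPresentation {
  pres_1 : lmodType R;
  pres_0 : lmodType R;
  pres_d : {linear pres_1 -> pres_0};
  pres_aug : {linear pres_0 -> X};
  pres_fg1 : fin_gen pres_1;
  pres_fg0 : fin_gen pres_0;
  pres_projective1 : projective pres_1;
  pres_projective0 : projective pres_0;
  pres_exact : exact_at pres_d pres_aug;
  pres_aug_surj : surjective pres_aug }.

Section Transpose.
Variables (X : lmodType R) (p : proj_presentation X).

Definition dual_image : pred {linear pres_1 p -> R^o} :=
  fun f => `[< exists g : {linear pres_0 p -> R^o},
                 forall x, f x = g (pres_d p x) >].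

Fact dual_image_submod : submod_closed dual_image.
Proof.
split=> [|a f g /asboolP[f' f'E] /asboolP[g' g'E]]; apply/asboolP.
  by exists \0.
by exists (a *: f' + g') => x; rewrite /= -f'E -g'E.
Qed.

(* Depends on the presentation p, up to projective summands. *)
Definition transpose : lmodType R := lmod_quot dual_image_submod.

End Transpose.

Definition in_H X : Prop :=
  fin_gen X /\ forall i, (0 < i)%N -> ext_vanishes i X R^o.

(* The condition on transpose p does not depend on p: a projective summand
   does not affect the vanishing of Ext in positive degrees. *)
Definition in_G X : Prop :=
  [/\ fin_gen X,
      forall i, (0 < i)%N -> ext_vanishes i X R^o &
      forall (p : proj_presentation X) i, (0 < i)%N ->
        ext_vanishes i (transpose p) R^o].

(* Full subcategories of mod R are given by their objects. *)
Record subcategory (C : lmodType R -> Prop) : Prop := Subcategory {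
  subcat_fg : forall X, C X -> fin_gen X;
  subcat_iso : forall X Y, iso_mod X Y -> C X -> C Y;
  subcat_sum : forall X Y, fin_gen X -> fin_gen Y ->
    C (X * Y)%type <-> C X /\ C Y;
  subcat_proj : forall P, fin_gen P -> projective P -> C P }.

Record resolving (C : lmodType R -> Prop) : Prop := Resolving {
  resolving_ext : forall X Y Z (f : {linear X -> Y}) (g : {linear Y -> Z}),
    fin_gen X -> fin_gen Y -> fin_gen Z -> short_exact f g ->
    C X -> C Z -> C Y;
  resolving_ker : forall X Y Z (f : {linear X -> Y}) (g : {linear Y -> Z}),
    fin_gen X -> fin_gen Y -> fin_gen Z -> short_exact f g ->
    C Y -> C Z -> C X }.

Definition zero_mod X : Prop := forall x : X, x = 0.

Definition indecomposable (C : lmodType R -> Prop) X : Prop :=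
  [/\ C X, ~ zero_mod X &
      forall Y Z, C Y -> C Z -> iso_mod X (Y * Z)%type ->
        zero_mod Y \/ zero_mod Z].

Definition finite_type (C : lmodType R -> Prop) : Prop :=
  exists (n : nat) (E : 'I_n -> lmodType R),
    forall X, indecomposable C X -> exists i, iso_mod X (E i).

End Modules.

Section PairMap.
Variables (R : comNzRingType) (M P Q : lmodType R).
Variables (f : {linear M -> P}) (g : {linear M -> Q}).

Definition pair_map (x : M) : (P * Q)%type := (f x, g x).
Fact pair_map_linear : linear pair_map.
Proof. by move=> a x y; rewrite /pair_map !linearP. Qed.
HB.instance Definition _ :=
  GRing.isLinear.Build R M (P * Q)%type *:%R pair_map pair_map_linear.

End PairMap.

Lemma projective_prod (R : comNzRingType) (P Q : lmodType R) :
  projective P -> projective Q -> projective (P * Q)%type.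
Proof.
move=> hP hQ M N p f ps.
have [g gE] := hP M N p (f \o pair_map idfun \0) ps.
have [h hE] := hQ M N p (f \o pair_map \0 idfun) ps.
exists (hom_add (g \o fst) (h \o snd)) => -[x y].
rewrite /= linearD gE hE /= -linearD /pair_map /=.
by congr (f _); congr pair; rewrite /= ?addr0 ?add0r.
Qed.

Section Stable.
Variable R : comNzRingType.
Implicit Types X Y Z : lmodType R.

(* P(X, Y) *)
Definition factors_proj X Y : {pred {linear X -> Y}} :=
  fun f => `[< exists (P : lmodType R) (u : {linear X -> P})
                      (v : {linear P -> Y}),
                 projective P /\ forall x, f x = v (u x) >].

Fact factors_proj_submod X Y : submod_closed (@factors_proj X Y).
Proof.
split=> [|a f g]; last first.
  move=> /asboolP[P [u [v [hP fE]]]] /asboolP[Q [u' [v' [hQ gE]]]].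
  apply/asboolP; exists (P * Q)%type, (pair_map u u').
  exists (hom_add ((a *: v) \o fst) (v' \o snd)).
  split; first exact: projective_prod.
  by move=> x; rewrite /= -fE -gE.
apply/asboolP; exists 'rV[R]_0, \0, \0; split=> [M N p f _|//].
by exists \0 => x; rewrite /= (thinmx0 x) !linear0.
Qed.

Lemma factors_proj_compl X Y Z (g : {linear Y -> Z}) (f : {linear X -> Y}) :
  f \in @factors_proj X Y -> (g \o f : {linear X -> Z}) \in @factors_proj X Z.
Proof.
move=> /asboolP[P [u [v [hP fE]]]]; apply/asboolP.
by exists P, u, (g \o v); split=> // x /=; rewrite fE.
Qed.

Lemma factors_proj_compr X Y Z (g : {linear Y -> Z}) (f : {linear X -> Y}) :
  g \in @factors_proj Y Z -> (g \o f : {linear X -> Z}) \in @factors_proj X Z.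
Proof.
move=> /asboolP[P [u [v [hP gE]]]]; apply/asboolP.
by exists P, (u \o f), v; split=> // x /=; rewrite gE.
Qed.

Definition stable_hom X Y : lmodType R := lmod_quot (@factors_proj_submod X Y).

Definition stable_pi X Y : {linear X -> Y} -> stable_hom X Y :=
  @lmod_pi _ _ _ (@factors_proj_submod X Y).

Definition stable_id X : stable_hom X X := stable_pi idfun.

Definition stable_comp X Y Z (g : stable_hom Y Z) (f : stable_hom X Y) :
  stable_hom X Z := stable_pi (repr g \o repr f).

Lemma stable_pi_surj X Y (z : stable_hom X Y) : exists f, stable_pi f = z.
Proof. exact: lmod_pi_surj. Qed.

Lemma stable_piD X Y (f g : {linear X -> Y}) :
  stable_pi (f + g) = stable_pi f + stable_pi g.
Proof. exact: lmod_piD. Qed.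

Lemma stable_compE X Y Z (g : {linear Y -> Z}) (f : {linear X -> Y}) :
  stable_comp (stable_pi g) (stable_pi f) = stable_pi (g \o f).
Proof.
set g' := repr (stable_pi g); set f' := repr (stable_pi f).
have eg : g' - g \in @factors_proj Y Z.
  by apply/(lmod_pi_eq (@factors_proj_submod Y Z)); rewrite /lmod_pi reprK.
have ef : f' - f \in @factors_proj X Y.
  by apply/(lmod_pi_eq (@factors_proj_submod X Y)); rewrite /lmod_pi reprK.
apply/lmod_pi_eq.
have -> : (g' \o f' : {linear X -> Z}) - (g \o f : {linear X -> Z}) =
    1 *: (g' \o (f' - f) : {linear X -> Z}) + ((g' - g) \o f : {linear X -> Z}).
  apply: linear_ext => x; rewrite scale1r !hom_addE /=.
  by rewrite linearB /= addrA addrNK.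
apply: (@factors_proj_submod X Z).2.
  exact: factors_proj_compl.
exact: factors_proj_compr.
Qed.

End Stable.

Record preadditive := Preadditive {
  pobj :> Type;
  phom : pobj -> pobj -> zmodType;
  pid : forall X, phom X X;
  pcomp : forall X Y Z, phom Y Z -> phom X Y -> phom X Z;
  pcompA : forall X Y Z T (h : phom Z T) (g : phom Y Z) (f : phom X Y),
    pcomp h (pcomp g f) = pcomp (pcomp h g) f;
  pcomp1f : forall X Y (f : phom X Y), pcomp (pid Y) f = f;
  pcompf1 : forall X Y (f : phom X Y), pcomp f (pid X) = f;
  pcompDl : forall X Y Z (g g' : phom Y Z) (f : phom X Y),
    pcomp (g + g') f = pcomp g f + pcomp g' f;
  pcompDr : forall X Y Z (g : phom Y Z) (f f' : phom X Y),
    pcomp g (f + f') = pcomp g f + pcomp g f' }.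

Local Obligation Tactic := idtac.

Section StableCategory.
Variables (R : comNzRingType) (C : lmodType R -> Prop).

Program Definition stable_category : preadditive := {|
  pobj := {X : lmodType R | C X};
  phom X Y := stable_hom (sval X) (sval Y);
  pid X := stable_id (sval X);
  pcomp X Y Z g f := stable_comp g f |}.
Next Obligation.
move=> X Y Z T h g f.
have [h' <-] := stable_pi_surj h; have [g' <-] := stable_pi_surj g.
have [f' <-] := stable_pi_surj f.
by rewrite !stable_compE; congr stable_pi; apply: linear_ext.
Qed.
Next Obligation.
move=> X Y f; have [f' <-] := stable_pi_surj f.
by rewrite stable_compE; congr stable_pi; apply: linear_ext.
Qed.
Next Obligation.
move=> X Y f; have [f' <-] := stable_pi_surj f.
by rewrite stable_compE; congr stable_pi; apply: linear_ext.
Qed.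
Next Obligation.
move=> X Y Z g1 g2 f; have [h1 <-] := stable_pi_surj g1.
have [h2 <-] := stable_pi_surj g2; have [f' <-] := stable_pi_surj f.
rewrite -stable_piD !stable_compE -stable_piD.
by congr stable_pi; apply: linear_ext.
Qed.
Next Obligation.
move=> X Y Z g f1 f2; have [h1 <-] := stable_pi_surj f1.
have [h2 <-] := stable_pi_surj f2; have [g' <-] := stable_pi_surj g.
rewrite -stable_piD !stable_compE -stable_piD.
by congr stable_pi; apply: linear_ext => x /=; rewrite linearD.
Qed.

End StableCategory.

Section Functors.
Variable A : preadditive.

(* Contravariant additive functors from A to abelian groups. *)
Record cfunctor := CFunctor {
  cf_obj :> A -> zmodType;
  cf_map : forall X Y : A, phom X Y -> {additive cf_obj Y -> cf_obj X};
  cf_id : forall (X : A) (y : cf_obj X), cf_map (pid X) y = y;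
  cf_comp : forall (X Y Z : A) (g : phom Y Z) (f : phom X Y) (z : cf_obj Z),
    cf_map (pcomp g f) z = cf_map f (cf_map g z);
  cf_add : forall (X Y : A) (f g : phom X Y) (y : cf_obj Y),
    cf_map (f + g) y = cf_map f y + cf_map g y }.

Record nattrans (F G : cfunctor) := NatTrans {
  nt_map :> forall X : A, {additive F X -> G X};
  nt_natural : forall (X Y : A) (f : phom X Y) (y : F Y),
    nt_map X (cf_map F f y) = cf_map G f (nt_map Y y) }.

Lemma nattrans_ext (F G : cfunctor) (s t : nattrans F G) :
  (forall X, s X =1 t X) -> s = t.
Proof.
case: s t => [s hs] [t ht] /= e.
have est : s = t by apply: functional_extensionality_dep => X; apply/additive_ext/e.
by move: hs; rewrite est => hs; rewrite (Prop_irrelevance hs ht).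
Qed.

Definition nt_id (F : cfunctor) : nattrans F F :=
  @NatTrans F F (fun X => idfun) (fun X Y f y => erefl).

Program Definition nt_comp (F G H : cfunctor)
    (t : nattrans G H) (s : nattrans F G) : nattrans F H :=
  @NatTrans F H (fun X => t X \o s X) _.
Next Obligation.
by move=> F G H t s X Y f y /=; rewrite !nt_natural.
Qed.

Section Representable.
Variables (Z X Y : A) (f : phom X Y).

Definition precomp (g : phom Y Z) : phom X Z := pcomp g f.

Fact precomp_zmod_morphism : zmod_morphism precomp.
Proof.
move=> g h; apply/eqP; rewrite eq_sym subr_eq; apply/eqP.
by rewrite /precomp -pcompDl subrK.
Qed.
HB.instance Definition _ :=
  GRing.isZmodMorphism.Build (phom Y Z) (phom X Z) precomp
    precomp_zmod_morphism.

End Representable.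

Program Definition hom_functor (Z : A) : cfunctor :=
  @CFunctor (fun X => phom X Z) (fun X Y f => precomp f) _ _ _.
Next Obligation. by move=> Z X y; apply: pcompf1. Qed.
Next Obligation. by move=> Z X Y T g f z; apply: pcompA. Qed.
Next Obligation. by move=> Z X Y f g y; apply: pcompDr. Qed.

Definition finitely_presented (F : cfunctor) : Prop :=
  exists (X1 X0 : A) (a : nattrans (hom_functor X1) (hom_functor X0))
         (b : nattrans (hom_functor X0) F),
    forall Y : A, surjective (b Y) /\
      forall y, b Y y = 0 <-> exists x, a Y x = y.

End Functors.

(* The zmodType structure is left out of the morphism sets: the natural
   transformations below live in a universe above that of zmodType. *)
Record category := Category {
  obj :> Type;
  hom : obj -> obj -> Type;
  cid : forall X, hom X X;
  ccomp : forall X Y Z, hom Y Z -> hom X Y -> hom X Z;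
  ccompA : forall X Y Z T (h : hom Z T) (g : hom Y Z) (f : hom X Y),
    ccomp h (ccomp g f) = ccomp (ccomp h g) f;
  ccomp1f : forall X Y (f : hom X Y), ccomp (cid Y) f = f;
  ccompf1 : forall X Y (f : hom X Y), ccomp f (cid X) = f }.

Program Definition mod_category (A : preadditive) : category := {|
  obj := {F : cfunctor A | finitely_presented F};
  hom F G := nattrans (sval F) (sval G);
  cid F := nt_id (sval F);
  ccomp F G H t s := nt_comp t s |}.
Next Obligation. by move=> *; apply: nattrans_ext. Qed.
Next Obligation. by move=> *; apply: nattrans_ext. Qed.
Next Obligation. by move=> *; apply: nattrans_ext. Qed.

Section Abelian.
Variable A : category.
Implicit Types X Y Z : A.

Definition mono X Y (f : hom X Y) : Prop :=
  forall Z (g h : hom Z X), ccomp f g = ccomp f h -> g = h.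

Definition epi X Y (f : hom X Y) : Prop :=
  forall Z (g h : hom Y Z), ccomp g f = ccomp h f -> g = h.

Definition zero_object Z : Prop :=
  (forall X, exists! f : hom X Z, True) /\ (forall X, exists! f : hom Z X, True).

Definition zero_morphism X Y (f : hom X Y) : Prop :=
  exists Z (a : hom X Z) (b : hom Z Y), zero_object Z /\ f = ccomp b a.

Definition is_product X Y P (p : hom P X) (q : hom P Y) : Prop :=
  forall Z (f : hom Z X) (g : hom Z Y),
    exists! h : hom Z P, ccomp p h = f /\ ccomp q h = g.

Definition is_coproduct X Y S (i : hom X S) (j : hom Y S) : Prop :=
  forall Z (f : hom X Z) (g : hom Y Z),
    exists! h : hom S Z, ccomp h i = f /\ ccomp h j = g.

Definition is_kernel X Y (f : hom X Y) K (k : hom K X) : Prop :=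
  zero_morphism (ccomp f k) /\
  forall Z (g : hom Z X), zero_morphism (ccomp f g) ->
    exists! h : hom Z K, ccomp k h = g.

Definition is_cokernel X Y (f : hom X Y) Q (q : hom Y Q) : Prop :=
  zero_morphism (ccomp q f) /\
  forall Z (g : hom Y Z), zero_morphism (ccomp g f) ->
    exists! h : hom Q Z, ccomp h q = g.

(* Freyd's axioms: no additive structure is given on the morphism sets, since
   these axioms determine one. *)
Record abelian : Prop := Abelian {
  abelian_zero : exists Z, zero_object Z;
  abelian_product : forall X Y,
    exists P (p : hom P X) (q : hom P Y), is_product p q;
  abelian_coproduct : forall X Y,
    exists S (i : hom X S) (j : hom Y S), is_coproduct i j;
  abelian_kernel : forall X Y (f : hom X Y),
    exists K (k : hom K X), is_kernel f k;
  abelian_cokernel : forall X Y (f : hom X Y),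
    exists Q (q : hom Y Q), is_cokernel f q;
  abelian_mono : forall K X (k : hom K X), mono k ->
    exists Y (f : hom X Y), is_kernel f k;
  abelian_epi : forall Y Q (q : hom Y Q), epi q ->
    exists X (f : hom X Y), is_cokernel f q }.

Definition projective_object P : Prop :=
  forall X Y (e : hom X Y) (f : hom P Y), epi e ->
    exists g : hom P X, ccomp e g = f.

Definition injective_object I : Prop :=
  forall X Y (m : hom X Y) (f : hom X I), mono m ->
    exists g : hom Y I, ccomp g m = f.

Definition enough_projectives : Prop :=
  forall X, exists P (e : hom P X), projective_object P /\ epi e.

Definition enough_injectives : Prop :=
  forall X, exists I (m : hom X I), injective_object I /\ mono m.

Record frobenius : Prop := Frobenius {
  frobenius_abelian : abelian;
  frobenius_projectives : enough_projectives;
  frobenius_injectives : enough_injectives;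
  frobenius_proj_inj : forall X, projective_object X -> injective_object X;
  frobenius_inj_proj : forall X, injective_object X -> projective_object X }.

End Abelian.

(* Main.v *)
(* Write Om for the syzygy functor on the stable category of C, which is full and
   faithful because Ext^1(C, R) = 0. Finite type and noetherianity (without
   Krull-Schmidt) give an object M such that every object of C is a summand of
   a power of M. For a full embedding G of the stable category into itself, the
   endomorphisms of M that annihilate all maps from the image of G form a
   submodule of the noetherian module End(M); taking G with this one maximal and
   comparing G with G \o Om shows that a map annihilating every map out of a
   syzygy is stably zero. The dual statement holds in the same way, and together
   they make every X in C a stable summand of a syzygy. Hence each X in C embeds
   in a finitely generated projective module with cokernel in C.

   Iterating these cosyzygies and dualizing resolves Tr X, so X lies in G. They
   also complete every map of the stable category to a sequence of weak kernels
   and weak cokernels in both directions: on finitely presented functors this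
   says that representables are injective and that every functor embeds in a
   representable one, which is the Frobenius property. *)

From HB Require Import structures.
From mathcomp Require Import all_boot all_algebra.
From mathcomp Require Import boolp classical_sets.
Require Import Defs.

Set Implicit Arguments.
Unset Strict Implicit.
Unset Printing Implicit Defensive.

Import GRing.Theory.
Local Open Scope ring_scope.
Local Open Scope quotient_scope.

Local Obligation Tactic := idtac.

(** * Modules over a noetherian ring *)

(** The obstacle is density: no hypothesis directly provides an embedding of an object of [C] in a
    projective module with cokernel in [C], and [Om] is a priori only full and faithful. With unique
    decompositions one could argue by pigeonhole: [Om] would act injectively, hence bijectively, on
    the finitely many isomorphism classes of indecomposable objects of the stable category. Here the
    ascending chain condition on submodules of the stable endomorphism module of [M] takes over the
    role of the pigeonhole. It is applied to annihilators rather than to objects, and all full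
    embeddings are considered at once because their class is closed under composition with [Om],
    which can only enlarge an annihilator.

    The exactness statements in the stable category rest on one construction, the short exact
    sequence 0 -> K -> X * R^n -> Y -> 0 attached to f : X -> Y and a free cover of Y. K lies in [C]
    because [C] is resolving, K -> X is a weak kernel of f, and Ext^1(Y, R) = 0 makes f a weak
    cokernel of K -> X. *)

Section LinearMaps.
Variable R : comNzRingType.
Implicit Types U V W K T : lmodType R.

Lemma linear_map_of U V (f : U -> V) :
  linear f -> exists g : {linear U -> V}, forall x, g x = f x.
Proof.
move=> hf.
pose g := GRing.isLinear.Build R U V *:%R f hf.
by exists (HB.pack_for {linear U -> V} f g).
Qed.

Lemma lift_injection K U T (i : {linear K -> U}) (h : {linear T -> U}) :
  injective i -> (forall t, exists k, i k = h t) ->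
  exists h' : {linear T -> K}, forall t, i (h' t) = h t.
Proof.
move=> inj_i /choice[h' h'E].
have [|g gE] := @linear_map_of _ _ h'.
  by move=> a x y; apply: inj_i; rewrite linearP !h'E linearP.
by exists g => t; rewrite gE.
Qed.

Lemma descend_surjection U V W (s : {linear U -> V}) (h : {linear U -> W}) :
  surjective s -> (forall u, s u = 0 -> h u = 0) ->
  exists h' : {linear V -> W}, forall u, h' (s u) = h u.
Proof.
move=> /choice[r rE] hk.
have hE u : h (r (s u)) = h u.
  by apply/eqP; rewrite -subr_eq0 -linearB hk // linearB /= rE subrr.
have [|g gE] := @linear_map_of _ _ (h \o r).
  move=> a x y /=; rewrite -linearP -[in RHS]hE; congr (h (r _)).
  by rewrite linearP !rE.
by exists g => u; rewrite gE /= hE.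
Qed.

End LinearMaps.

Section Kernel.
Variables (R : comNzRingType) (U V : lmodType R) (f : {linear U -> V}).

Definition ker_pred : {pred U} := fun x => f x == 0.
Fact ker_pred_submod : submod_closed ker_pred.
Proof.
split=> [|a x y /eqP fx /eqP fy]; first by apply/eqP; rewrite linear0.
by apply/eqP; rewrite linearP fx fy scaler0 addr0.
Qed.
HB.instance Definition _ :=
  GRing.isSubmodClosed.Build R U ker_pred ker_pred_submod.

Record ker_mod := KerMod { ker_val :> U; ker_valP : ker_val \in ker_pred }.
HB.instance Definition _ := [isSub for ker_val].
HB.instance Definition _ := [Choice of ker_mod by <:].
HB.instance Definition _ := [SubChoice_isSubLmodule of ker_mod by <:].

Lemma ker_modE (x : ker_mod) : f (ker_val x) = 0.
Proof. by apply/eqP; exact: ker_valP. Qed.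

Lemma kernel_exists : exists (K : lmodType R) (i : {linear K -> U}),
  injective i /\ exact_at i f.
Proof.
exists ker_mod, (\val : {linear ker_mod -> U}); split; first exact: val_inj.
move=> x; split=> [fx|[k <-]]; last exact: ker_modE.
by exists (@KerMod x (introT eqP fx)).
Qed.

End Kernel.

Section Noetherian.
Variable R : comNzRingType.
Implicit Types U V W : lmodType R.

Definition is_submod V (S : set V) : Prop :=
  S 0 /\ forall a x y, S x -> S y -> S (a *: x + y).

Definition fg_set V (S : set V) : Prop :=
  exists (n : nat) (g : 'I_n -> V), forall x,
    S x <-> exists c : 'I_n -> R, x = \sum_(i < n) c i *: g i.

Lemma fg_set_fin V (S : set V) (I : finType) (g : I -> V) :
  (forall x, S x <-> exists c : I -> R, x = \sum_i c i *: g i) -> fg_set S.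
Proof.
move=> Sg; exists #|I|, (g \o enum_val) => x; split=> [/Sg[c ->]|[c ->]].
  exists (c \o enum_val); rewrite (reindex_onto enum_val enum_rank) /=.
    by apply: eq_bigl => i; rewrite enum_valK eqxx.
  by move=> i _; rewrite enum_rankK.
apply/Sg; exists (c \o enum_rank).
rewrite [RHS](reindex_onto enum_val enum_rank) /=.
  by apply: eq_big => [i|i _]; rewrite enum_valK ?eqxx.
by move=> i _; rewrite enum_rankK.
Qed.

Lemma submodB V (S : set V) x y : is_submod S -> S x -> S y -> S (x - y).
Proof. by case=> _ h Sx Sy; rewrite addrC -scaleN1r; apply: h. Qed.

Lemma submod_sum V (S : set V) (I : finType) (c : I -> R) (g : I -> V) :
  is_submod S -> (forall i, S (g i)) -> S (\sum_i c i *: g i).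
Proof.
move=> [S0 h] Sg; elim/big_ind: _ => // [x y Sx Sy|i _].
  by rewrite -[x]scale1r; apply: h.
by rewrite -[_ *: _]addr0; apply: h.
Qed.

(** Induction on the number of generators, as in Hilbert's basis theorem: S is generated by lifts of
    generators of its ideal of leading coefficients, together with generators of its intersection
    with the span of the first n elements. *)
Lemma noetherian_submod_span n V (g : 'I_n -> V) (S : set V) :
  noetherian R -> is_submod S ->
  (forall x, S x -> exists c : 'I_n -> R, x = \sum_(i < n) c i *: g i) ->
  fg_set S.
Proof.
move=> nR; elim: n V g S => [|n IHn] V g S hS Sg.
  exists 0%N, g => x; split=> [/Sg //|[c ->]].
  by rewrite big_ord0; apply: hS.1.
pose g' (i : 'I_n) := g (widen_ord (leqnSn n) i).
pose T x := exists c : 'I_n -> R, x = \sum_(i < n) c i *: g' i.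
have hT : is_submod T.
  split; first by exists (fun=> 0); rewrite big1 // => i _; rewrite scale0r.
  move=> a x y [c ->] [d ->]; exists (fun i => a * c i + d i).
  rewrite scaler_sumr -big_split; apply: eq_bigr => i _.
  by rewrite scalerDl scalerA.
(* the ideal of leading coefficients, along the last generator *)
pose I (a : R) := exists2 s, S s & T (s - a *: g ord_max).
have hI : is_ideal I.
  split; first by exists 0; [exact: hS.1|rewrite scale0r subr0; exact: hT.1].
  move=> a x y [s Ss Ts] [t St Tt]; exists (a *: s + t); first exact: hS.2.
  rewrite scalerDl -scalerA opprD addrACA -scalerBr; exact: hT.2.
have [k [a Ia]] := nR I hI.
have /choice[s sP] (j : 'I_k) : exists s, S s /\ T (s - a j *: g ord_max).
  have /Ia[s Ss Ts] : exists c : 'I_k -> R, a j = \sum_(i < k) c i * a i.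
    exists (fun i => (i == j)%:R); rewrite (bigD1 j) //= eqxx mul1r big1 ?addr0 //.
    by move=> i /negbTE->; rewrite mul0r.
  by exists s.
pose S' x := S x /\ T x.
have hS' : is_submod S'.
  split; first by split; [exact: hS.1|exact: hT.1].
  by move=> b x y [Sx Tx] [Sy Ty]; split; [exact: hS.2|exact: hT.2].
have [|m [h hE]] := IHn V g' S' hS' _; first by move=> x [].
pose G (u : 'I_k + 'I_m) := match u with inl j => s j | inr i => h i end.
apply: (@fg_set_fin _ _ _ G) => x; split.
  move=> Sx; have [c cE] := Sg x Sx; rewrite big_ord_recr /= in cE.
  have Tx : T (x - c ord_max *: g ord_max).
    by rewrite cE addrK; exists (fun i => c (widen_ord (leqnSn n) i)).
  have /Ia[d dE] : I (c ord_max) by exists x.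
  have : S' (x - \sum_j d j *: s j).
    split.
      by apply: submodB => //; apply: submod_sum => // j; case: (sP j).
    have -> : x - \sum_j d j *: s j = (x - c ord_max *: g ord_max)
        - \sum_j d j *: (s j - a j *: g ord_max).
      under [in RHS]eq_bigr do rewrite scalerBr scalerA.
      by rewrite sumrB -scaler_suml -dE opprB addrA subrK.
    by apply: submodB => //; apply: submod_sum => // j; case: (sP j).
  move=> /hE[e eE].
  exists (fun u => match u with inl j => d j | inr i => e i end).
  by rewrite big_sumType /= -eE addrC subrK.
move=> [c ->]; apply: submod_sum => // -[j|i] /=; first by case: (sP j).
suff [] : S' (h i) by [].
apply/hE; exists (fun l => (l == i)%:R).
rewrite (bigD1 i) //= eqxx scale1r big1 ?addr0 //.
by move=> l /negbTE->; rewrite scale0r.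
Qed.

Lemma noetherian_submod V (S : set V) :
  noetherian R -> fin_gen V -> is_submod S -> fg_set S.
Proof.
move=> nR [n [g gE]] hS.
by apply: (@noetherian_submod_span n V g) => // x _; apply: gE.
Qed.

(** Without a maximal member, choice produces a strictly increasing chain in [F]. Its union is a
    finitely generated submodule, whose generators all lie in one member of the chain. *)
Lemma noetherian_maximal V (F : set V -> Prop) :
  noetherian R -> fin_gen V -> (forall S, F S -> is_submod S) ->
  (exists S, F S) ->
  exists2 S, F S & forall S', F S' -> (S `<=` S' -> S' `<=` S)%classic.
Proof.
move=> nR fV Fsub [S0 FS0].
apply: contrapT => noMax.
have next (S : {S | F S}) : exists S' : {S | F S},
    (sval S `<=` sval S')%classic /\ ~ (sval S' `<=` sval S)%classic.
  apply: contrapT => h; apply: noMax; exists (sval S); first exact: svalP.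
  move=> S' FS' SS'; apply: contrapT => nS; apply: h.
  by exists (exist _ S' FS').
have [nx nxP] := choice next.
pose ch := fix ch i := if i is j.+1 then nx (ch j) else exist F S0 FS0.
have ch_le i j : (i <= j)%N -> (sval (ch i) `<=` sval (ch j))%classic.
  elim: j => [|j IHj]; first by rewrite leqn0 => /eqP->.
  rewrite leq_eqVlt => /predU1P[->//|]; rewrite ltnS => /IHj le_ij.
  by move=> x /le_ij; apply: (nxP (ch j)).1.
pose U x := exists i, sval (ch i) x.
have hU : is_submod U.
  split; first by exists 0%N; apply: (Fsub _ (svalP (ch 0%N))).1.
  move=> a x y [i ix] [j jy]; exists (maxn i j).
  apply: (Fsub _ (svalP (ch (maxn i j)))).2.
    exact: (ch_le _ _ (leq_maxl i j)).
  exact: (ch_le _ _ (leq_maxr i j)).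
have [n [g gE]] := noetherian_submod nR fV hU.
have /choice[k kP] (i : 'I_n) : U (g i).
  apply/gE; exists (fun l => (l == i)%:R).
  rewrite (bigD1 i) //= eqxx scale1r big1 ?addr0 //.
  by move=> l /negbTE->; rewrite scale0r.
pose N := \max_i k i.
apply: (nxP (ch N)).2 => x Nx.
have /gE[c ->] : U x by exists N.+1.
apply: submod_sum; first exact: (Fsub _ (svalP (ch N))).
by move=> i; apply: (ch_le (k i)) => //; apply: leq_bigmax.
Qed.

Lemma fin_gen_surj V W (p : {linear V -> W}) :
  surjective p -> fin_gen V -> fin_gen W.
Proof.
move=> sp [n [g gE]]; exists n, (p \o g) => w; have [v <-] := sp w.
by have [c ->] := gE v; exists c; rewrite linear_sum; apply: eq_bigr => i _;
  rewrite linearZ.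
Qed.

Lemma fin_gen_inj V W (i : {linear V -> W}) :
  noetherian R -> injective i -> fin_gen W -> fin_gen V.
Proof.
move=> nR inj_i fW.
have [|n [g gE]] := @noetherian_submod W (fun w => exists v, i v = w) nR fW.
  split; first by exists 0; rewrite linear0.
  by move=> a _ _ [x <-] [y <-]; exists (a *: x + y); rewrite linearP.
have /choice[h hE] (j : 'I_n) : exists v, i v = g j.
  apply/gE; exists (fun l => (l == j)%:R).
  rewrite (bigD1 j) //= eqxx scale1r big1 ?addr0 //.
  by move=> l /negbTE->; rewrite scale0r.
exists n, h => v; have /gE[c cE] : exists u, i u = i v by exists v.
exists c; apply: inj_i; rewrite cE linear_sum; apply: eq_bigr => j _.
by rewrite linearZ /= hE.
Qed.

Lemma fin_gen_rV n : fin_gen 'rV[R]_n.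
Proof.
exists n, (fun i => delta_mx 0 i) => x; exists (fun i => x 0 i).
exact: row_sum_delta.
Qed.

Lemma free_map n V (g : 'I_n -> V) : exists p : {linear 'rV[R]_n -> V},
  forall x, p x = \sum_i x 0 i *: g i.
Proof.
apply: linear_map_of => a x y; rewrite scaler_sumr -big_split.
by apply: eq_bigr => i _; rewrite !mxE scalerDl scalerA.
Qed.

Lemma free_cover V : fin_gen V ->
  exists n (p : {linear 'rV[R]_n -> V}), surjective p.
Proof.
move=> [n [g gE]]; have [p pE] := free_map g; exists n, p => y.
have [c ->] := gE y; exists (\row_i c i); rewrite pE.
by apply: eq_bigr => i _; rewrite mxE.
Qed.

Lemma projective_rV n : projective 'rV[R]_n.
Proof.
move=> M N p f sp.
have /choice[g gE] (i : 'I_n) : exists m, p m = f (delta_mx 0 i) by apply: sp.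
have [h hE] := free_map g; exists h => x; rewrite hE linear_sum.
rewrite [in RHS](row_sum_delta x) linear_sum; apply: eq_bigr => i _.
by rewrite !linearZ /= gE.
Qed.

Lemma fin_gen_prod V W : fin_gen V -> fin_gen W -> fin_gen (V * W)%type.
Proof.
move=> /free_cover[n [p sp]] /free_cover[m [q sq]].
have [f fE] : exists f : {linear 'rV[R]_(n + m) -> (V * W)%type},
    forall x, f x = (p (lsubmx x), q (rsubmx x)).
  by apply: linear_map_of => a x y; rewrite !linearP.
apply: (@fin_gen_surj _ _ f); last exact: fin_gen_rV.
move=> [v w]; have [x <-] := sp v; have [y <-] := sq w.
by exists (row_mx x y); rewrite fE row_mxKl row_mxKr.
Qed.

(** Evaluation at n generators of V embeds Hom(V, W) in the n-th power of W, where noetherianity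
    applies. *)
Lemma fin_gen_hom V W :
  noetherian R -> fin_gen V -> fin_gen W -> fin_gen {linear V -> W}.
Proof.
move=> nR [n [g gE]] fW.
have [m [p sp]] := free_cover fW.
pose E := {ffun 'I_n -> W}.
have fE : fin_gen E.
  have [f fP] : exists f : {linear 'M[R]_(n, m) -> E},
      forall x, f x = [ffun i => p (row i x)].
    apply: linear_map_of => a x y; apply/ffunP => i; rewrite !ffunE.
    by rewrite !linearP.
  have [h hP] : exists h : {linear 'rV[R]_(n * m) -> E},
      forall x, h x = f (vec_mx x).
    by apply: linear_map_of => a x y; rewrite !linearP.
  apply: (@fin_gen_surj _ _ h); last exact: fin_gen_rV.
  move=> e; have /choice[r rE] (i : 'I_n) : exists r, p r = e i by apply: sp.
  exists (mxvec (\matrix_i r i)); rewrite hP fP mxvecK; apply/ffunP => i.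
  by rewrite ffunE rowK rE.
have [ev evE] : exists ev : {linear {linear V -> W} -> E},
    forall f, ev f = [ffun i => f (g i)].
  by apply: linear_map_of => a f h; apply/ffunP => i; rewrite !ffunE.
apply: (@fin_gen_inj _ _ ev nR _ fE) => f h.
rewrite !evE => /ffunP e; apply: linear_ext => x; have [c ->] := gE x.
rewrite !linear_sum; apply: eq_bigr => i _; rewrite !linearZ /=.
by have := e i; rewrite !ffunE => ->.
Qed.

End Noetherian.

(** * Finitely presented functors *)

Section AdditiveMaps.
Implicit Types U V W K T : zmodType.

Definition mk_additive U V (f : U -> V) (hf : zmod_morphism f) :
    {additive U -> V} :=
  let m := GRing.isZmodMorphism.Build U V f hf in
  HB.pack_for {additive U -> V} f m.

Lemma additive_map_of U V (f : U -> V) :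
  zmod_morphism f -> exists g : {additive U -> V}, forall x, g x = f x.
Proof. by move=> hf; exists (mk_additive hf). Qed.

Lemma additive_lift_injection K U T (i : {additive K -> U})
    (h : {additive T -> U}) :
  injective i -> (forall t, exists k, i k = h t) ->
  exists h' : {additive T -> K}, forall t, i (h' t) = h t.
Proof.
move=> inj_i /choice[h' h'E].
have [|g gE] := @additive_map_of _ _ h'.
  by move=> x y; apply: inj_i; rewrite raddfB !h'E raddfB.
by exists g => t; rewrite gE.
Qed.

Lemma additive_descend_surjection U V W (s : {additive U -> V})
    (h : {additive U -> W}) :
  surjective s -> (forall u, s u = 0 -> h u = 0) ->
  exists h' : {additive V -> W}, forall u, h' (s u) = h u.
Proof.
move=> /choice[r rE] hk.
have hE u : h (r (s u)) = h u.
  by apply/eqP; rewrite -subr_eq0 -raddfB hk // raddfB /= rE subrr.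
have [|g gE] := @additive_map_of _ _ (h \o r).
  move=> x y /=; rewrite -raddfB -[in RHS]hE; congr (h (r _)).
  by rewrite raddfB !rE.
by exists g => u; rewrite gE /= hE.
Qed.

End AdditiveMaps.

Section AdditiveKernel.
Variables (U V : zmodType) (f : {additive U -> V}).

Definition zker_pred : {pred U} := fun x => f x == 0.
Fact zker_pred_zmod_closed : zmod_closed zker_pred.
Proof.
split=> [|x y /eqP fx /eqP fy]; first by apply/eqP; rewrite raddf0.
by apply/eqP; rewrite raddfB fx fy subr0.
Qed.
HB.instance Definition _ :=
  GRing.isZmodClosed.Build U zker_pred zker_pred_zmod_closed.

Record zker := ZKer { zker_val :> U; zker_valP : zker_val \in zker_pred }.
HB.instance Definition _ := [isSub for zker_val].
HB.instance Definition _ := [Choice of zker by <:].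
HB.instance Definition _ := [SubChoice_isSubZmodule of zker by <:].

Lemma zker_exists : exists (K : zmodType) (i : {additive K -> U}),
  injective i /\ forall x, f x = 0 <-> exists k, i k = x.
Proof.
exists zker, (\val : {additive zker -> U}); split; first exact: val_inj.
move=> x; split=> [fx|[k <-]]; first by exists (@ZKer x (introT eqP fx)).
by apply/eqP; exact: zker_valP.
Qed.

Definition zim_pred : {pred V} := fun y => `[< exists x, f x = y >].
Fact zim_pred_zmod_closed : zmod_closed zim_pred.
Proof.
split=> [|_ _ /asboolP[x <-] /asboolP[y <-]]; apply/asboolP.
  by exists 0; rewrite raddf0.
by exists (x - y); rewrite raddfB.
Qed.
HB.instance Definition _ :=
  GRing.isZmodClosed.Build V zim_pred zim_pred_zmod_closed.

Lemma zcoker_exists : exists (Q : zmodType) (q : {additive V -> Q}),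
  surjective q /\ forall y, q y = 0 <-> exists x, f x = y.
Proof.
pose Q : zmodType := Quotient.quot zim_pred.
have [|q qE] := @additive_map_of V Q (\pi_(Quotient.quot zim_pred)).
  by move=> x y; rewrite pi_is_additive.
exists Q, q; split=> [z|y]; first by exists (repr z); rewrite qE reprK.
rewrite qE; split=> [e|h].
  suff /asboolP : y \in zim_pred by [].
  rewrite -[y]subr0 Quotient.idealrBE; apply/eqP; rewrite e.
  by rewrite -(raddf0 q) qE.
rewrite -(raddf0 q) qE; apply/eqP; rewrite -Quotient.idealrBE subr0.
exact/asboolP.
Qed.

End AdditiveKernel.

Section Preadditive.
Variable A : preadditive.
Implicit Types X Y Z T : A.

Lemma pcomp0f X Y Z (f : phom X Y) : pcomp (0 : phom Y Z) f = 0.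
Proof. by apply: (addrI (pcomp 0 f)); rewrite -pcompDl !addr0. Qed.

Lemma pcompf0 X Y Z (f : phom Y Z) : pcomp f (0 : phom X Y) = 0.
Proof. by apply: (addrI (pcomp f 0)); rewrite -pcompDr !addr0. Qed.

Lemma pcompNl X Y Z (g : phom Y Z) (f : phom X Y) : pcomp (- g) f = - pcomp g f.
Proof.
by apply: (addrI (pcomp g f)); rewrite -pcompDl !subrr pcomp0f.
Qed.

Lemma pcompNr X Y Z (g : phom Y Z) (f : phom X Y) : pcomp g (- f) = - pcomp g f.
Proof.
by apply: (addrI (pcomp g f)); rewrite -pcompDr !subrr pcompf0.
Qed.

Lemma pcompBl X Y Z (g h : phom Y Z) (f : phom X Y) :
  pcomp (g - h) f = pcomp g f - pcomp h f.
Proof. by rewrite pcompDl pcompNl. Qed.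

Lemma pcompBr X Y Z (g : phom Y Z) (f h : phom X Y) :
  pcomp g (f - h) = pcomp g f - pcomp g h.
Proof. by rewrite pcompDr pcompNr. Qed.

End Preadditive.

Section Functors.
Variable A : preadditive.
Implicit Types (X Y Z : A) (F G H K Q T : cfunctor A).

Lemma cf_map0 F X Y (y : F Y) : cf_map F (0 : phom X Y) y = 0.
Proof. by apply: (addrI (cf_map F 0 y)); rewrite -cf_add !addr0. Qed.

Lemma cf_mapB F X Y (f g : phom X Y) (y : F Y) :
  cf_map F (f - g) y = cf_map F f y - cf_map F g y.
Proof. by apply/eqP; rewrite eq_sym subr_eq -cf_add subrK. Qed.

Lemma nattrans_lift K F T (k : nattrans K F) (g : nattrans T F) :
  (forall X, injective (k X)) -> (forall X t, exists x, k X x = g X t) ->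
  exists h : nattrans T K, forall X t, k X (h X t) = g X t.
Proof.
move=> inj_k kg.
pose h X := sval (boolp.cid (additive_lift_injection (inj_k X) (kg X))).
have hE X t : k X (h X t) = g X t by rewrite /h; case: boolp.cid.
have nat_h X Y (f : phom X Y) y : h X (cf_map T f y) = cf_map K f (h Y y).
  by apply: (inj_k _); rewrite nt_natural !hE nt_natural.
by exists (NatTrans nat_h).
Qed.

Lemma nattrans_descend F Q T (q : nattrans F Q) (g : nattrans F T) :
  (forall X, surjective (q X)) -> (forall X x, q X x = 0 -> g X x = 0) ->
  exists h : nattrans Q T, forall X x, h X (q X x) = g X x.
Proof.
move=> surj_q qg.
pose h X := sval (boolp.cid (additive_descend_surjection (surj_q X) (qg X))).
have hE X x : h X (q X x) = g X x by rewrite /h; case: boolp.cid.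
have nat_h X Y (f : phom X Y) y : h X (cf_map Q f y) = cf_map T f (h Y y).
  by have [x <-] := surj_q Y y; rewrite -nt_natural !hE nt_natural.
by exists (NatTrans nat_h).
Qed.

Lemma kernel_functor F G (t : nattrans F G) :
  exists (K : cfunctor A) (k : nattrans K F),
    forall X, injective (k X) /\ forall y, t X y = 0 <-> exists x, k X x = y.
Proof.
pose K X := sval (boolp.cid (zker_exists (t X))).
pose k X : {additive K X -> F X} := sval (boolp.cid (svalP (boolp.cid (zker_exists (t X))))).
have kP X : injective (k X) /\ forall y, t X y = 0 <-> exists x, k X x = y.
  exact: svalP (boolp.cid (svalP (boolp.cid (zker_exists (t X))))).
have inj_k X := (kP X).1; have kE X := (kP X).2.
have lift X Y (f : phom X Y) : exists h : {additive K Y -> K X},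
    forall y, k X (h y) = cf_map F f (k Y y).
  apply: (@additive_lift_injection _ _ _ (k X) (cf_map F f \o k Y)) => // y /=.
  by apply/kE; rewrite nt_natural (_ : t Y _ = 0) ?raddf0 //; apply/kE; exists y.
pose m X Y f := sval (boolp.cid (lift X Y f)).
have mE X Y (f : phom X Y) y : k X (m X Y f y) = cf_map F f (k Y y).
  by rewrite /m; case: boolp.cid.
have m1 X y : m X X (pid X) y = y by apply: (inj_k _); rewrite mE cf_id.
have mM X Y Z (g : phom Y Z) (f : phom X Y) z :
    m X Z (pcomp g f) z = m X Y f (m Y Z g z).
  by apply: (inj_k _); rewrite !mE cf_comp.
have mD X Y (f g : phom X Y) y : m X Y (f + g) y = m X Y f y + m X Y g y.
  by apply: (inj_k _); rewrite raddfD /= !mE cf_add.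
exists (CFunctor m1 mM mD).
by exists (@NatTrans _ (CFunctor m1 mM mD) F k mE).
Qed.

Lemma cokernel_functor F G (t : nattrans F G) :
  exists (Q : cfunctor A) (q : nattrans G Q),
    forall X, surjective (q X) /\ forall y, q X y = 0 <-> exists x, t X x = y.
Proof.
pose Q X := sval (boolp.cid (zcoker_exists (t X))).
pose q X : {additive G X -> Q X} := sval (boolp.cid (svalP (boolp.cid (zcoker_exists (t X))))).
have qP X : surjective (q X) /\ forall y, q X y = 0 <-> exists x, t X x = y.
  exact: svalP (boolp.cid (svalP (boolp.cid (zcoker_exists (t X))))).
have surj_q X := (qP X).1; have qE X := (qP X).2.
have descend X Y (f : phom X Y) : exists h : {additive Q Y -> Q X},
    forall y, h (q Y y) = q X (cf_map G f y).
  apply: (@additive_descend_surjection _ _ _ (q Y) (q X \o cf_map G f)) => // y.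
  by move=> /qE[x <-]; apply/qE; exists (cf_map F f x); rewrite nt_natural.
pose m X Y f := sval (boolp.cid (descend X Y f)).
have mE X Y (f : phom X Y) y : m X Y f (q Y y) = q X (cf_map G f y).
  by rewrite /m; case: boolp.cid.
have m1 X y : m X X (pid X) y = y.
  by have [z <-] := surj_q X y; rewrite mE cf_id.
have mM X Y Z (g : phom Y Z) (f : phom X Y) z :
    m X Z (pcomp g f) z = m X Y f (m Y Z g z).
  by have [y <-] := surj_q Z z; rewrite !mE cf_comp.
have mD X Y (f g : phom X Y) y : m X Y (f + g) y = m X Y f y + m X Y g y.
  by have [z <-] := surj_q Y y; rewrite !mE cf_add raddfD.
have nat_q X Y (f : phom X Y) y : q X (cf_map G f y) = m X Y f (q Y y).
  by rewrite mE.
exists (CFunctor m1 mM mD).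
by exists (@NatTrans _ G (CFunctor m1 mM mD) q nat_q).
Qed.

Section ProductFunctor.
Variables F G : cfunctor A.

Definition prod_map X Y (f : phom X Y) (u : (F Y * G Y)%type) :
  (F X * G X)%type := (cf_map F f u.1, cf_map G f u.2).
Fact prod_map_zmod_morphism X Y (f : phom X Y) : zmod_morphism (prod_map f).
Proof. by move=> u v; rewrite /prod_map !raddfB. Qed.

Program Definition prod_functor : cfunctor A :=
  @CFunctor A (fun X => (F X * G X)%type)
    (fun X Y f => mk_additive (prod_map_zmod_morphism f)) _ _ _.
Next Obligation. by move=> X [x y]; rewrite /= /prod_map !cf_id. Qed.
Next Obligation. by move=> *; rewrite /= /prod_map !cf_comp. Qed.
Next Obligation. by move=> *; rewrite /= /prod_map !cf_add. Qed.

Program Definition prod_fst : nattrans prod_functor F :=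
  @NatTrans A prod_functor F (fun X => fst) _.
Next Obligation. by []. Qed.
Program Definition prod_snd : nattrans prod_functor G :=
  @NatTrans A prod_functor G (fun X => snd) _.
Next Obligation. by []. Qed.

Lemma prod_nattrans H (s : nattrans H F) (t : nattrans H G) :
  exists h : nattrans H prod_functor, forall X x, h X x = (s X x, t X x).
Proof.
have m X : zmod_morphism (fun x => (s X x, t X x) : prod_functor X).
  by move=> x y; rewrite !raddfB.
have nat_m X Y (f : phom X Y) y :
    mk_additive (m X) (cf_map H f y) = cf_map prod_functor f (mk_additive (m Y) y).
  by rewrite /= /prod_map !nt_natural.
by exists (NatTrans nat_m).
Qed.

Lemma coprod_nattrans H (s : nattrans F H) (t : nattrans G H) :
  exists h : nattrans prod_functor H,
    forall X (u : prod_functor X), h X u = s X u.1 + t X u.2.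
Proof.
have m X : zmod_morphism (fun u : prod_functor X => s X u.1 + t X u.2).
  by move=> x y; rewrite !raddfB opprD addrACA.
have nat_m X Y (f : phom X Y) y :
    mk_additive (m X) (cf_map prod_functor f y) = cf_map H f (mk_additive (m Y) y).
  by rewrite /= /prod_map !nt_natural raddfD.
by exists (NatTrans nat_m).
Qed.

End ProductFunctor.

Lemma nt_zero_exists F G : exists t : nattrans F G, forall X x, t X x = 0.
Proof.
have m X : zmod_morphism (fun _ : F X => 0 : G X) by move=> x y; rewrite subr0.
have nat_m X Y (f : phom X Y) y :
    mk_additive (m X) (cf_map F f y) = cf_map G f (mk_additive (m Y) y).
  by rewrite /= raddf0.
by exists (NatTrans nat_m).
Qed.

Lemma yoneda F X (x : F X) : exists t : nattrans (hom_functor X) F,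
  forall Y (f : phom Y X), t Y f = cf_map F f x.
Proof.
have m Y : zmod_morphism (fun f : phom Y X => cf_map F f x).
  by move=> f g; rewrite cf_mapB.
have nat_m Y Z (f : phom Y Z) (g : hom_functor X Z) :
    mk_additive (m Y) (cf_map (hom_functor X) f g)
    = cf_map F f (mk_additive (m Z) g).
  by rewrite /= /precomp cf_comp.
by exists (NatTrans nat_m).
Qed.

Lemma nattrans_hom F X (t : nattrans (hom_functor X) F) Y (f : phom Y X) :
  t Y f = cf_map F f (t X (pid X)).
Proof. by rewrite -nt_natural /= /precomp pcomp1f. Qed.

(** By Yoneda an element x of F X is a transformation Hom(-, X) -> F. [generator] says that it is
    surjective, and [fg_relations] that its kernel is the image of a representable functor. The
    later arguments compute with such elements instead of with transformations. *)
Definition generator F X (x : F X) : Prop :=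
  forall Y (y : F Y), exists f : phom Y X, y = cf_map F f x.

Definition fg_relations F X (x : F X) : Prop :=
  exists W (a : phom W X), forall Y (f : phom Y X),
    cf_map F f x = 0 <-> exists g : phom Y W, f = pcomp a g.

Lemma finitely_presentedE F : finitely_presented F <->
  exists X (x : F X), generator x /\ fg_relations x.
Proof.
split=> [[W [X [a [b ab]]]]|[X [x [gen_x [W [a aE]]]]]].
  exists X, (b X (pid X)); split=> [Y y|].
    by have [f <-] := (ab Y).1 y; exists f; rewrite -nattrans_hom.
  exists W, (a W (pid W)) => Y f; rewrite -nattrans_hom (ab Y).2.
  by split=> -[g]; [move<-|move->]; exists g; rewrite nattrans_hom.
have [b bE] := yoneda x; have [a' a'E] := @yoneda (hom_functor X) W a.
exists W, X, a', b => Y; split=> [y|y].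
  by have [f ->] := gen_x _ y; exists f; rewrite bE.
rewrite bE aE; split=> -[g]; [move->|move<-]; exists g; rewrite a'E //.
Qed.

Lemma descend_generator F G X (x : F X) (y : G X) : generator x ->
  (forall Y (f : phom Y X), cf_map F f x = 0 -> cf_map G f y = 0) ->
  exists t : nattrans F G, t X x = y.
Proof.
move=> gen_x xy; have [b bE] := yoneda x; have [c cE] := yoneda y.
have [|Y f|t tE] := @nattrans_descend _ _ _ b c.
- by move=> Y z; have [f ->] := gen_x _ z; exists f; rewrite bE.
- by rewrite bE cE; apply: xy.
by exists t; rewrite -[x]cf_id -bE tE cE cf_id.
Qed.

End Functors.

(** * A Frobenius criterion for finitely presented functors *)

Section FrobeniusCriterion.
Variable A : preadditive.
Implicit Types X Y Z : A.

(** This is exactness of Hom(-, W) -> Hom(-, X) -> Hom(-, Y) in the middle; the factorization h need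
    not be unique. [weak_cokernel] is the same for covariant functors. *)
Definition weak_kernel X Y (f : phom X Y) W (k : phom W X) : Prop :=
  forall Z (g : phom Z X), pcomp f g = 0 <-> exists h, g = pcomp k h.

Definition weak_cokernel X Y (f : phom X Y) W (d : phom Y W) : Prop :=
  forall Z (g : phom Y Z), pcomp g f = 0 <-> exists h, g = pcomp h d.

Hypothesis A_zero : exists O : A, forall X (f : phom X O), f = 0.
Hypothesis A_biproduct : forall X Y,
  exists S (i : phom X S) (j : phom Y S) (p : phom S X) (q : phom S Y),
    [/\ pcomp p i = pid X, pcomp q j = pid Y, pcomp q i = 0, pcomp p j = 0
      & pcomp i p + pcomp j q = pid S].
(** Weak kernels make finitely presented functors closed under kernels. The second half, that every
    map is a weak cokernel of its weak kernel, makes representable functors injective. The next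
    hypothesis embeds every finitely presented functor in a representable one. *)
Hypothesis A_weak_kernel : forall X Y (f : phom X Y),
  exists W (k : phom W X), weak_kernel f k /\ weak_cokernel k f.
Hypothesis A_is_weak_kernel : forall X Y (f : phom X Y),
  exists W (d : phom Y W), weak_kernel d f.

(** If y = x h and [a] generates the relations of x, then f is a relation of y exactly when h f
    factors through [a]. So the relations of y form a weak pullback of h and [a], obtained as a weak
    kernel on the biproduct of Y and W. *)
Lemma fg_relations_generated (F : cfunctor A) X (x : F X) Y (y : F Y) :
  generator x -> fg_relations x -> fg_relations y.
Proof.
move=> gen_x [W [a aE]]; have [h yE] := gen_x _ y.
have [S [i [j [p [q [pi qj qi pj ipjq]]]]]] := A_biproduct Y W.
have [V [k [kE _]]] := A_weak_kernel (pcomp h p - pcomp a q).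
have hk : pcomp h (pcomp p k) = pcomp a (pcomp q k).
  apply/eqP; rewrite !pcompA -subr_eq0 -pcompBl; apply/eqP/kE.
  by exists (pid _); rewrite pcompf1.
exists V, (pcomp p k) => Z f; rewrite yE -cf_comp aE.
split=> [[g hf]|[g ->]]; last first.
  by exists (pcomp q (pcomp k g)); rewrite pcompA hk -!pcompA.
have /kE[u uE] : pcomp (pcomp h p - pcomp a q) (pcomp i f + pcomp j g) = 0.
  rewrite pcompBl !pcompDr -!pcompA !(pcompA p) !(pcompA q) pi qj qi pj.
  by rewrite !pcomp0f !pcompf0 !pcomp1f addr0 add0r hf subrr.
exists u; rewrite -pcompA -uE pcompDr !pcompA pi pj.
by rewrite pcomp0f addr0 pcomp1f.
Qed.

Lemma finitely_presentedP (F : cfunctor A) : finitely_presented F <->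
  (exists X (x : F X), generator x) /\
  (forall X (x : F X), fg_relations x).
Proof.
rewrite finitely_presentedE; split=> [[X [x [gx rx]]]|[[X [x gx]] r]].
  by split; [exists X, x|move=> Y y; apply: fg_relations_generated gx rx].
by exists X, x.
Qed.

Lemma fp_hom_functor X : finitely_presented (hom_functor X).
Proof.
apply/finitely_presentedP; split=> [|Y x].
  by exists X, (pid X) => Y f; exists f; rewrite /= /precomp pcomp1f.
by have [W [k [kE _]]] := A_weak_kernel x; exists W, k.
Qed.

(** If x generates F and [a] generates the relations of t x in G, then x a lies in K and generates
    it. Relations of an element of K are those of its image in F. *)
Lemma fp_kernel (F G K : cfunctor A) (t : nattrans F G) (k : nattrans K F) :
  (forall X, injective (k X) /\ forall y, t X y = 0 <-> exists x, k X x = y) ->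
  finitely_presented F -> finitely_presented G -> finitely_presented K.
Proof.
move=> kP /finitely_presentedP[[X [x gx]] rF] /finitely_presentedP[_ rG].
apply/finitely_presentedP; split=> [|Y y]; last first.
  have [W [a aE]] := rF _ (k Y y); exists W, a => Z f.
  rewrite -aE -nt_natural; split=> [->|e]; first by rewrite raddf0.
  by apply: (kP Z).1; rewrite e raddf0.
have [W [a aE]] := rG _ (t X x).
have [z zE] : exists z, k W z = cf_map F a x.
  by apply/(kP W).2; rewrite nt_natural; apply/aE; exists (pid _); rewrite pcompf1.
exists W, z => Y y; have [f fE] := gx _ (k Y y).
have /aE[g gE] : cf_map G f (t X x) = 0.
  by rewrite -nt_natural -fE; apply/(kP Y).2; exists y.
by exists g; apply: (kP Y).1; rewrite nt_natural zE fE gE cf_comp.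
Qed.

(** A relation of q w is a map f for which w f = t (x h) for some h. The pairs (f, h) are the
    relations of one element of G on the biproduct of Z and X. *)
Lemma fp_cokernel (F G Q : cfunctor A) (t : nattrans F G) (q : nattrans G Q) :
  (forall X, surjective (q X) /\ forall y, q X y = 0 <-> exists x, t X x = y) ->
  finitely_presented F -> finitely_presented G -> finitely_presented Q.
Proof.
move=> qP /finitely_presentedP[[X [x gx]] _].
move=> /finitely_presentedP[[Y [y gy]] rG].
apply/finitely_presentedP; split.
  exists Y, (q Y y) => Z z; have [z' <-] := (qP Z).1 z.
  by have [f ->] := gy _ z'; exists f; rewrite nt_natural.
move=> Z z; have [w <-] := (qP Z).1 z.
have [S [i [j [p [r [pi rj ri pj ipjr]]]]]] := A_biproduct Z X.
have [W [a aE]] := rG _ (cf_map G p w - cf_map G r (t X x)).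
exists W, (pcomp p a) => T f; rewrite -nt_natural (qP T).2.
split=> [[s sE]|[g ->]].
  have [h hE] := gx _ s.
  have /aE[g gE] : cf_map G (pcomp i f + pcomp j h)
      (cf_map G p w - cf_map G r (t X x)) = 0.
    rewrite raddfB -!cf_comp !pcompDr !pcompA pi rj ri pj !pcomp0f !pcomp1f.
    by rewrite addr0 add0r -sE hE nt_natural subrr.
  exists g; rewrite -pcompA -gE pcompDr !pcompA pi pj.
  by rewrite pcomp0f addr0 pcomp1f.
exists (cf_map F (pcomp r (pcomp a g)) x).
rewrite nt_natural -pcompA !(@cf_comp _ G _ _ _ _ (pcomp a g)).
apply/eqP; rewrite eq_sym -subr_eq0 -raddfB; apply/eqP.
by apply/aE; exists g.
Qed.

Lemma fp_prod_functor (F G : cfunctor A) : finitely_presented F ->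
  finitely_presented G -> finitely_presented (prod_functor F G).
Proof.
move=> /finitely_presentedP[[X [x gx]] rF] /finitely_presentedP[[Y [y gy]] rG].
apply/finitely_presentedP; split=> [|Z [z1 z2]].
  have [S [i [j [p [q [pi qj qi pj ipjq]]]]]] := A_biproduct X Y.
  exists S, (cf_map F p x, cf_map G q y) => Z [z1 z2].
  have [f fE] := gx _ z1; have [g gE] := gy _ z2.
  exists (pcomp i f + pcomp j g); rewrite /= /prod_map /= -!cf_comp.
  rewrite !pcompDr !pcompA pi qj qi pj !pcomp0f !pcomp1f addr0 add0r.
  by rewrite -fE -gE.
have [V [a aE]] := rF _ z1; have [W [b bE]] := rG _ (cf_map G a z2).
exists W, (pcomp a b) => T f; rewrite /= /prod_map /=.
split=> [[] /aE[g ->]|[h ->]].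
  by rewrite cf_comp => /bE[h ->]; exists h; rewrite pcompA.
congr pair; first by apply/aE; exists (pcomp b h); rewrite pcompA.
by rewrite -pcompA cf_comp; apply/bE; exists h.
Qed.

Local Notation Mod := (mod_category A).

Lemma mod_hom_eq (F G : Mod) (s t : hom F G) : s = t -> forall X x,
  (s : nattrans (sval F) (sval G)) X x = (t : nattrans (sval F) (sval G)) X x.
Proof. by move->. Qed.

(** The pointwise kernel is itself finitely presented, so a monomorphism can be tested on its
    inclusion and the zero map. *)
Lemma mod_mono_inj (F G : Mod) (t : hom F G) : mono t ->
  forall X, injective ((t : nattrans (sval F) (sval G)) X).
Proof.
move=> mono_t; have [K [k kP]] := kernel_functor (t : nattrans (sval F) (sval G)).
have fpK := fp_kernel kP (svalP F) (svalP G).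
have [z zE] := nt_zero_exists K (sval F).
have kz : k = z.
  apply: (mono_t (exist _ K fpK)); apply: nattrans_ext => X x /=.
  by rewrite zE raddf0; apply/(kP X).2; exists x.
move=> X; apply: raddf_inj => x /(kP X).2[y <-].
by rewrite kz zE.
Qed.

Lemma mod_inj_mono (F G : Mod) (t : nattrans (sval F) (sval G)) :
  (forall X, injective (t X)) -> @mono Mod F G t.
Proof.
move=> inj_t Z g h e; apply: nattrans_ext => X x; apply: (inj_t X).
exact: (mod_hom_eq e x).
Qed.

Lemma mod_epi_surj (F G : Mod) (t : hom F G) : epi t ->
  forall X, surjective ((t : nattrans (sval F) (sval G)) X).
Proof.
move=> epi_t.
have [Q [q qP]] := cokernel_functor (t : nattrans (sval F) (sval G)).
have fpQ := fp_cokernel qP (svalP F) (svalP G).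
have [z zE] := nt_zero_exists (sval G) Q.
have qz : q = z.
  apply: (epi_t (exist _ Q fpQ)); apply: nattrans_ext => X x /=.
  by rewrite zE; apply/(qP X).2; exists x.
by move=> X y; apply/(qP X).2; rewrite qz zE.
Qed.

Lemma mod_surj_epi (F G : Mod) (t : nattrans (sval F) (sval G)) :
  (forall X, surjective (t X)) -> @epi Mod F G t.
Proof.
move=> surj_t Z g h e; apply: nattrans_ext => X y.
have [x <-] := surj_t X y.
exact: (mod_hom_eq e x).
Qed.

Lemma mod_zero_object : exists O : Mod, zero_object O /\
  forall X (x : sval O X), x = 0.
Proof.
have [O OP] := A_zero; pose F : Mod := exist _ _ (fp_hom_functor O).
exists F; split; last exact: OP.
split=> G.
  have [z zE] := nt_zero_exists (sval G) (sval F).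
  by exists z; split=> // f _; apply: nattrans_ext => X x; rewrite zE [RHS]OP.
have [z zE] := nt_zero_exists (sval F) (sval G).
exists z; split=> // f _; apply: nattrans_ext => X x.
by rewrite zE (OP _ x) raddf0.
Qed.

Lemma mod_zero_morphismE (F G : Mod) (t : nattrans (sval F) (sval G)) :
  @zero_morphism Mod F G t <-> forall X x, t X x = 0.
Proof.
split=> [[O [a [b [[_ O0] ->]]]] X x|t0].
  have [z zE] := nt_zero_exists (sval O) (sval G).
  have [u [_ uE]] := O0 G.
  rewrite -(uE b I) (uE z I) /=; exact: zE.
have [O [zO OP]] := mod_zero_object.
have [a aE] := nt_zero_exists (sval F) (sval O).
have [b bE] := nt_zero_exists (sval O) (sval G).
by exists O, a, b; split=> //; apply: nattrans_ext => X x /=; rewrite bE t0.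
Qed.

Lemma mod_is_kernel (F G K : Mod) (t : nattrans (sval F) (sval G))
    (k : nattrans (sval K) (sval F)) :
  (forall X, injective (k X) /\ forall y, t X y = 0 <-> exists x, k X x = y) ->
  @is_kernel Mod F G t K k.
Proof.
move=> kP; split=> [|Z g /mod_zero_morphismE tg].
  by apply/mod_zero_morphismE => X x /=; apply/(kP X).2; exists x.
have [||h hE] := @nattrans_lift _ _ _ _ k g.
- by move=> X; exact: (kP X).1.
- by move=> X z; apply/(kP X).2; exact: tg.
exists h; split=> [|h' h'E]; first by apply: nattrans_ext => X x; exact: hE.
apply: nattrans_ext => X x; apply: (kP X).1; rewrite hE.
exact: (mod_hom_eq (esym h'E) x).
Qed.

Lemma mod_is_cokernel (F G Q : Mod) (t : nattrans (sval F) (sval G))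
    (q : nattrans (sval G) (sval Q)) :
  (forall X, surjective (q X) /\ forall y, q X y = 0 <-> exists x, t X x = y) ->
  @is_cokernel Mod F G t Q q.
Proof.
move=> qP; split=> [|Z g /mod_zero_morphismE gt].
  by apply/mod_zero_morphismE => X x /=; apply/(qP X).2; exists x.
have [||h hE] := @nattrans_descend _ _ _ _ q g.
- by move=> X; exact: (qP X).1.
- by move=> X z /(qP X).2[x <-]; exact: gt.
exists h; split=> [|h' h'E]; first by apply: nattrans_ext => X x; exact: hE.
apply: nattrans_ext => X x; have [y <-] := (qP X).1 x; rewrite hE.
exact: (mod_hom_eq (esym h'E) y).
Qed.

Lemma mod_abelian : abelian Mod.
Proof.
split.
- by have [O [zO _]] := mod_zero_object; exists O.
- move=> F G.
  pose P : Mod := exist _ _ (fp_prod_functor (svalP F) (svalP G)).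
  exists P, (prod_fst (sval F) (sval G)), (prod_snd (sval F) (sval G)).
  move=> Z f g; have [h hE] := prod_nattrans f g; exists h; split.
    by split; apply: nattrans_ext => X x /=; rewrite hE.
  move=> h' [ef eg]; apply: nattrans_ext => X x; rewrite hE -ef -eg /=.
  exact: esym (surjective_pairing _).
- move=> F G.
  pose P : Mod := exist _ _ (fp_prod_functor (svalP F) (svalP G)).
  have [zFG zFGE] := nt_zero_exists (sval F) (sval G).
  have [zGF zGFE] := nt_zero_exists (sval G) (sval F).
  have [i iE] := prod_nattrans (nt_id (sval F)) zFG.
  have [j jE] := prod_nattrans zGF (nt_id (sval G)).
  exists P, i, j => Z f g; have [h hE] := coprod_nattrans f g; exists h; split.
    split; apply: nattrans_ext => X x /=.
      by rewrite hE iE /= zFGE raddf0 addr0.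
    by rewrite hE jE /= zGFE raddf0 add0r.
  move=> h' [ef eg]; apply: nattrans_ext => X [x y]; rewrite hE -ef -eg /=.
  rewrite -raddfD iE jE zFGE zGFE; apply: congr1.
  by congr pair; rewrite /= ?addr0 ?add0r.
- move=> F G t.
  have [K [k kP]] := kernel_functor (t : nattrans (sval F) (sval G)).
  exists (exist _ K (fp_kernel kP (svalP F) (svalP G))), k.
  exact: mod_is_kernel.
- move=> F G t.
  have [Q [q qP]] := cokernel_functor (t : nattrans (sval F) (sval G)).
  exists (exist _ Q (fp_cokernel qP (svalP F) (svalP G))), q.
  exact: mod_is_cokernel.
- move=> F G t /mod_mono_inj inj_t.
  have [Q [q qP]] := cokernel_functor (t : nattrans (sval F) (sval G)).
  exists (exist _ Q (fp_cokernel qP (svalP F) (svalP G))), q.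
  by apply: mod_is_kernel => X; split; [exact: inj_t|exact: (qP X).2].
- move=> F G t /mod_epi_surj surj_t.
  have [K [k kP]] := kernel_functor (t : nattrans (sval F) (sval G)).
  exists (exist _ K (fp_kernel kP (svalP F) (svalP G))), k.
  by apply: mod_is_cokernel => X; split; [exact: surj_t|exact: (kP X).2].
Qed.

Definition mod_hom (X : A) : Mod := exist _ _ (fp_hom_functor X).

Lemma mod_hom_projective X : projective_object (mod_hom X).
Proof.
move=> F G e f /mod_epi_surj surj_e.
have [y yE] := surj_e X ((f : nattrans (hom_functor X) (sval G)) X (pid X)).
have [t tE] := yoneda y; exists t; apply: nattrans_ext => Y h /=.
by rewrite tE nt_natural yE -nattrans_hom.
Qed.

(** Let y generate G and let b : W -> Y generate the relations of y in the cokernel of m, so that y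
    b = m x for some x. An extension of f to G amounts to an image d : Y -> X of y, and it has to
    satisfy d b = f x. Such a d exists because b is a weak cokernel of its weak kernel k, and x k =
    0 as m is injective and b k = 0. *)
Lemma mod_hom_injective X : injective_object (mod_hom X).
Proof.
move=> F G m f mono_m.
pose m' : nattrans (sval F) (sval G) := m.
pose f' : nattrans (sval F) (hom_functor X) := f.
have inj_m : forall Y, injective (m' Y) := mod_mono_inj mono_m.
have [Q [q qP]] := cokernel_functor m'.
have /finitely_presentedP[_ rQ] := fp_cokernel qP (svalP F) (svalP G).
have /finitely_presentedP[[Y [y gy]] _] := svalP G.
have [W [b bE]] := rQ _ (q Y y).
have bE' Z (h : phom Z Y) :
    (exists x, m' Z x = cf_map (sval G) h y) <-> exists g, h = pcomp b g.
  by rewrite -bE -nt_natural (qP Z).2.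
have [x xE] : exists x, m' W x = cf_map (sval G) b y.
  by apply/bE'; exists (pid _); rewrite pcompf1.
have [V [k [kE kco]]] := A_weak_kernel b.
have bk : pcomp b k = 0 by apply/kE; exists (pid _); rewrite pcompf1.
have /kco[d dE] : pcomp (f' W x : phom W X) k = 0.
  rewrite -[LHS]/(cf_map (hom_functor X) k (f' W x)) -nt_natural.
  suff -> : cf_map (sval F) k x = 0 by rewrite raddf0.
  by apply: inj_m; rewrite nt_natural xE -cf_comp bk cf_map0 raddf0.
have [Z h hy|t tE] := @descend_generator _ (sval G) (hom_functor X) _ y d gy.
  have [g hE] : exists g, h = pcomp b g.
    by apply/bE'; exists 0; rewrite raddf0.
  rewrite /= /precomp hE pcompA -dE.
  rewrite -[LHS]/(cf_map (hom_functor X) g (f' W x)) -nt_natural.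
  suff -> : cf_map (sval F) g x = 0 by rewrite raddf0.
  by apply: inj_m; rewrite nt_natural xE -cf_comp -hE hy raddf0.
exists t; apply: nattrans_ext => Z z /=.
have [h hE] := gy _ (m' Z z); rewrite -/m' hE nt_natural tE /= /precomp.
have [g gE] : exists g, h = pcomp b g by apply/bE'; exists z.
have -> : z = cf_map (sval F) g x.
  by apply: inj_m; rewrite nt_natural xE hE gE cf_comp.
by rewrite nt_natural gE pcompA -dE.
Qed.

Lemma mod_enough_projectives (F : Mod) :
  exists X (e : hom (mod_hom X) F), epi e.
Proof.
have /finitely_presentedP[[X [x gx]] _] := svalP F.
have [t tE] := yoneda x; exists X, t; apply: mod_surj_epi => Y y.
by have [f ->] := gx _ y; exists f; rewrite tE.
Qed.

(** F is the cokernel of Hom(-, a). If [a] is a weak kernel of d : X -> Y, this cokernel is the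
    image of Hom(-, d) inside Hom(-, Y). *)
Lemma mod_enough_injectives (F : Mod) :
  exists X (m : hom F (mod_hom X)), mono m.
Proof.
have /finitely_presentedE[X [x [gx [W [a aE]]]]] := svalP F.
have [Y [d dE]] := A_is_weak_kernel a.
have [Z h|t tE] := @descend_generator _ (sval F) (hom_functor Y) _ x d gx.
  by rewrite aE -dE.
exists Y, t; apply: mod_inj_mono => Z; apply: raddf_inj => z.
have [h ->] := gx _ z; rewrite nt_natural tE /= /precomp => /dE.
by move/aE.
Qed.

Lemma mod_frobenius : frobenius Mod.
Proof.
split; first exact: mod_abelian.
- move=> F; have [X [e epi_e]] := mod_enough_projectives F.
  by exists (mod_hom X), e; split=> //; apply: mod_hom_projective.
- move=> F; have [X [m mono_m]] := mod_enough_injectives F.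
  by exists (mod_hom X), m; split=> //; apply: mod_hom_injective.
- move=> P hP F G m f mono_m.
  have [X [e epi_e]] := mod_enough_projectives P.
  have [s se] := hP _ _ e (cid P) epi_e.
  have [g gE] := mod_hom_injective (ccomp s f) mono_m.
  by exists (ccomp e g); rewrite -ccompA gE ccompA se ccomp1f.
- move=> I hI F G e f epi_e.
  have [X [m mono_m]] := mod_enough_injectives I.
  have [r rm] := hI _ _ m (cid I) mono_m.
  have [g gE] := mod_hom_projective (ccomp f r) epi_e.
  by exists (ccomp g m); rewrite ccompA gE -ccompA rm ccompf1.
Qed.

End FrobeniusCriterion.

(** * Stably zero maps and first extension groups *)

Section StablyZero.
Variable R : comNzRingType.
Implicit Types X Y Z P V : lmodType R.

Definition stably_zero X Y (f : {linear X -> Y}) : Prop :=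
  exists (P : lmodType R) (u : {linear X -> P}) (v : {linear P -> Y}),
    projective P /\ forall x, f x = v (u x).

Lemma stable_pi_eq0 X Y (f : {linear X -> Y}) :
  stable_pi f = 0 <-> stably_zero f.
Proof.
have -> : 0 = stable_pi (0 : {linear X -> Y}).
  by apply: (addrI (stable_pi f)); rewrite -stable_piD !addr0.
split=> [/(lmod_pi_eq (@factors_proj_submod _ X Y))|h].
  by rewrite subr0 => /asboolP.
by apply/(lmod_pi_eq (@factors_proj_submod _ X Y)); rewrite subr0; apply/asboolP.
Qed.

Lemma stable_piN X Y (f : {linear X -> Y}) : stable_pi (- f) = - stable_pi f.
Proof.
apply/eqP; rewrite -addr_eq0 -stable_piD addNr; apply/eqP/stable_pi_eq0.
by exists 'rV[R]_0, \0, \0; split=> //; apply: projective_rV.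
Qed.

Lemma stable_pi_eq X Y (f g : {linear X -> Y}) :
  stable_pi f = stable_pi g <-> stably_zero (f - g).
Proof.
rewrite -stable_pi_eq0 stable_piD stable_piN; split=> [->|/eqP].
  by rewrite subrr.
by rewrite subr_eq0 => /eqP.
Qed.

Lemma stable_piZ X Y a (f : {linear X -> Y}) :
  stable_pi (a *: f) = a *: stable_pi f.
Proof.
exact: esym (lmod_quot_scaleE (@factors_proj_submod _ X Y) a f).
Qed.

Lemma stable_pi_linear X Y : linear (@stable_pi R X Y).
Proof. by move=> a f g; rewrite stable_piD stable_piZ. Qed.

Lemma fin_gen_stable_hom X Y :
  noetherian R -> fin_gen X -> fin_gen Y -> fin_gen (stable_hom X Y).
Proof.
move=> nR fX fY; have [p pE] := linear_map_of (@stable_pi_linear X Y).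
apply: (@fin_gen_surj _ _ _ p); last exact: fin_gen_hom.
by move=> z; have [f <-] := stable_pi_surj z; exists f; rewrite pE.
Qed.

(** This replaces the unspecified projective module of a stably zero map by any chosen cover of the
    target, usually a free module. *)
Lemma stably_zero_lift X Y V (f : {linear X -> Y}) (p : {linear V -> Y}) :
  stably_zero f -> surjective p ->
  exists l : {linear X -> V}, forall x, p (l x) = f x.
Proof.
move=> [P [u [v [hP fE]]]] sp; have [w wE] := hP _ _ p v sp.
by exists (w \o u) => x /=; rewrite wE fE.
Qed.

End StablyZero.

Section Ext1.
Variable R : comNzRingType.
Implicit Types X Y Z K N P : lmodType R.

(** Vanishing of Ext^1(X, N) in a form that refers to no resolution: Hom(Y, N) -> Hom(K, N) is
    surjective for every extension Y of X by K. *)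
Definition ext1 X N : Prop :=
  forall K Y (i : {linear K -> Y}) (p : {linear Y -> X}), short_exact i p ->
  forall f : {linear K -> N}, exists g : {linear Y -> N},
    forall k, g (i k) = f k.

(** One projective cover suffices because every extension Y of X by K' is the pushout of P along the
    induced map a' : K -> K'. Hence f on K' and an extension g of f a' to P glue to a map on Y. *)
Lemma ext1_cover X N K P (i : {linear K -> P}) (p : {linear P -> X}) :
  short_exact i p -> projective P ->
  (forall f : {linear K -> N}, exists g : {linear P -> N},
    forall k, g (i k) = f k) ->
  ext1 X N.
Proof.
move=> [inj_i ip sp] hP ext K' Y j q [inj_j jq sq] f.
have [a aE] := hP _ _ q p sq.
have [k|a' a'E] := lift_injection (h := a \o i) inj_j.
  have /jq[k' k'E] : q (a (i k)) = 0 by rewrite aE; apply/ip; exists k.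
  by exists k'.
have [g gE] := ext (f \o a').
pose s : {linear (K' * P)%type -> Y} := hom_add (j \o fst) (a \o snd).
pose h : {linear (K' * P)%type -> N} := hom_add (f \o fst) (g \o snd).
have [y|[k v]|r rE] := @descend_surjection _ _ _ _ s h.
- have [v vE] := sp (q y).
  have /jq[k kE] : q (y - a v) = 0 by rewrite linearB /= aE vE subrr.
  by exists (k, v); rewrite /= kE subrK.
- rewrite /= => e.
  have /ip[l lE] : p v = 0.
    rewrite -aE; have := congr1 q e; rewrite linearD linear0.
    by rewrite (_ : q (j k) = 0) ?add0r //; apply/jq; exists k.
  have -> : k = - a' l.
    apply: inj_j; rewrite linearN a'E /= lE; apply/eqP.
    by rewrite -addr_eq0 e.
  by rewrite -lE gE linearN /= addNr.
exists r => k; have := rE (k, 0).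
by rewrite /= !linear0 !addr0.
Qed.

Lemma ext1_rV X n : ext1 X R^o -> ext1 X 'rV[R]_n.
Proof.
move=> ext K Y i p ip f.
have /choice[g gE] (j : 'I_n) : exists g : {linear Y -> R^o},
    forall k, g (i k) = f k 0 j.
  have [|fj fjE] := @linear_map_of R K R^o (fun k => f k 0 j).
    by move=> a x y; rewrite linearP !mxE.
  by have [g gE] := ext _ _ i p ip fj; exists g => k; rewrite gE fjE.
have [|h hE] := @linear_map_of R Y 'rV[R]_n (fun y => \row_j g j y).
  by move=> a x y; apply/rowP => j; rewrite !mxE linearP.
by exists h => k; rewrite hE; apply/rowP => j; rewrite mxE gE.
Qed.

End Ext1.

(** * Chosen free covers and the free resolutions built from them *)

Section Covers.
Variable R : comNzRingType.
Hypothesis R_noetherian : noetherian R.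

Section Cover.
Variable X : {X : lmodType R | fin_gen X}.

Definition cover_size : nat := sval (boolp.cid (free_cover (svalP X))).
Definition cover : {linear 'rV[R]_cover_size -> sval X} :=
  sval (boolp.cid (svalP (boolp.cid (free_cover (svalP X))))).
Lemma cover_surj : surjective cover.
Proof. exact: svalP (boolp.cid (svalP (boolp.cid (free_cover (svalP X))))). Qed.

Definition cover_ker : lmodType R := ker_mod cover.
Definition cover_incl : {linear cover_ker -> 'rV[R]_cover_size} :=
  (\val : {linear ker_mod cover -> 'rV[R]_cover_size}).

Lemma cover_exact : short_exact cover_incl cover.
Proof.
split; [exact: val_inj| |exact: cover_surj].
move=> v; split=> [/eqP ev|[k <-]]; last exact: ker_modE.
by exists (KerMod ev).
Qed.

Lemma cover_ker_fg : fin_gen cover_ker.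
Proof.
apply: (fin_gen_inj (i := cover_incl)) => //; first exact: val_inj.
exact: fin_gen_rV.
Qed.

End Cover.

Definition next_syzygy (X : {X : lmodType R | fin_gen X}) :
  {X : lmodType R | fin_gen X} := exist _ _ (cover_ker_fg X).

Section FreeResolution.
Variable X : {X : lmodType R | fin_gen X}.

Definition syzygy_iter i := iter i next_syzygy X.
Local Notation S := syzygy_iter.

Definition free_res_d i :
    {linear 'rV[R]_(cover_size (S i.+1)) -> 'rV[R]_(cover_size (S i))} :=
  cover_incl (S i) \o cover (S i.+1).

Fact free_res_exact i : exact_at (free_res_d i.+1) (free_res_d i).
Proof.
move=> y; have [inj_i _ _] := cover_exact (S i).
rewrite -[free_res_d i y]/(cover_incl (S i) (cover (S i.+1) y)).
have -> : cover_incl (S i) (cover (S i.+1) y) = 0 <-> cover (S i.+1) y = 0.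
  by split=> [e|->]; [apply: inj_i; rewrite linear0|rewrite linear0].
have [_ -> _] := cover_exact (S i.+1).
split=> [[k <-]|[z <-]]; last by eexists.
by have [z <-] := @cover_surj (S i.+2) k; exists z.
Qed.

Fact free_res_exact0 : exact_at (free_res_d 0) (cover X).
Proof.
move=> y; have [_ -> _] := cover_exact X.
split=> [[k <-]|[z <-]]; last by eexists.
by have [z <-] := @cover_surj (S 1%N) k; exists z.
Qed.

Definition free_resolution : proj_resolution (sval X) :=
  @ProjResolution _ _ (fun i => 'rV[R]_(cover_size (S i))) free_res_d (cover X)
    (fun i => @projective_rV R _) free_res_exact free_res_exact0 (@cover_surj X).

End FreeResolution.

(** A map f on the first syzygy, composed with its free cover, is a 1-cocycle of the free
    resolution; writing it as a coboundary extends f to the cover of X. *)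
Lemma ext1_of_vanishing (X N : lmodType R) :
  fin_gen X -> ext_vanishes 1 X N -> ext1 X N.
Proof.
move=> fX van; pose X' : {X | fin_gen X} := exist _ X fX.
apply: (ext1_cover (cover_exact X')); first exact: projective_rV.
move=> f; pose q : {linear 'rV[R]_(cover_size (next_syzygy X')) -> cover_ker X'} :=
  cover (next_syzygy X').
pose h : {linear 'rV[R]_(cover_size (next_syzygy X')) -> N} := f \o q.
have [x|g gE] := van (free_resolution X') h.
  have [_ e _] := cover_exact (next_syzygy X').
  rewrite /h /= (_ : q _ = 0) ?linear0 //.
  by apply/e; eexists; reflexivity.
exists g => k; have [z <-] := @cover_surj (next_syzygy X') k.
exact: esym (gE z).
Qed.

End Covers.

(** * Cones in the stable category *)

Section StableCategory.
Variables (R : comNzRingType) (C : lmodType R -> Prop).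
Local Notation A := (stable_category C).
Implicit Types X Y Z : A.

Lemma pcompE X Y Z (g : {linear sval Y -> sval Z})
    (f : {linear sval X -> sval Y}) :
  @pcomp A X Y Z (stable_pi g) (stable_pi f) = stable_pi (g \o f).
Proof. exact: stable_compE. Qed.

Lemma pcompZl X Y Z a (g : stable_hom (sval Y) (sval Z)) (f : phom X Y) :
  @pcomp A X Y Z (a *: g) f = a *: (@pcomp A X Y Z g f : stable_hom _ _).
Proof.
have [g' <-] := stable_pi_surj g; have [f' <-] := stable_pi_surj f.
rewrite -stable_piZ !pcompE -[RHS]stable_piZ; congr stable_pi.
exact: linear_ext.
Qed.

Lemma pcompZr X Y Z a (g : phom Y Z) (f : stable_hom (sval X) (sval Y)) :
  @pcomp A X Y Z g (a *: f) = a *: (@pcomp A X Y Z g f : stable_hom _ _).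
Proof.
have [g' <-] := stable_pi_surj g; have [f' <-] := stable_pi_surj f.
rewrite -stable_piZ !pcompE -[RHS]stable_piZ; congr stable_pi.
by apply: linear_ext => x /=; rewrite linearZ.
Qed.

Hypothesis R_noetherian : noetherian R.
Hypothesis C_subcategory : subcategory C.
Hypothesis C_resolving : resolving C.
Hypothesis C_ext1 : forall V, C V -> ext1 V R^o.

Let C_fg := subcat_fg C_subcategory.

Lemma subcat_rV n : C 'rV[R]_n.
Proof.
by apply: (subcat_proj C_subcategory); [apply: fin_gen_rV|apply: projective_rV].
Qed.

Lemma subcat_prod (V W : lmodType R) : C V -> C W -> C (V * W)%type.
Proof.
by move=> CV CW; apply/(subcat_sum C_subcategory); [exact: C_fg|exact: C_fg|].
Qed.

Lemma stable_zero : exists O : A, forall X (f : phom X O), f = 0.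
Proof.
exists (exist _ _ (subcat_rV 0)) => X f; have [f' <-] := stable_pi_surj f.
apply/stable_pi_eq0; exists 'rV[R]_0, f', idfun.
by split; first exact: projective_rV.
Qed.

Lemma stable_biproduct X Y :
  exists S (i : phom X S) (j : phom Y S) (p : phom S X) (q : phom S Y),
    [/\ pcomp p i = pid X, pcomp q j = pid Y, pcomp q i = 0, pcomp p j = 0
      & pcomp i p + pcomp j q = pid S].
Proof.
case: X Y => X CX [Y CY]; pose S : A := exist _ _ (subcat_prod CX CY).
pose i : {linear X -> (X * Y)%type} := pair_map idfun \0.
pose j : {linear Y -> (X * Y)%type} := pair_map \0 idfun.
pose p : {linear (X * Y)%type -> X} := fst.
pose q : {linear (X * Y)%type -> Y} := snd.
exists S, (stable_pi i), (stable_pi j), (stable_pi p), (stable_pi q).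
have z (V W : lmodType R) (f : {linear V -> W}) :
    (forall x, f x = 0) -> stable_pi f = 0.
  move=> f0; apply/stable_pi_eq0; exists 'rV[R]_0, \0, \0.
  by split=> //; exact: projective_rV.
split.
- by rewrite pcompE; congr stable_pi; apply: linear_ext.
- by rewrite pcompE; congr stable_pi; apply: linear_ext.
- by rewrite pcompE; exact: z.
- by rewrite pcompE; exact: z.
- rewrite !pcompE; apply: etrans (esym (stable_piD _ _)) _.
  congr stable_pi; apply: linear_ext => -[x y].
  by rewrite /= /pair_map /=; congr pair; rewrite /= ?addr0 ?add0r.
Qed.

Section Cone.
Variables (X Y : A) (f : {linear sval X -> sval Y}).
Variables (n : nat) (p : {linear 'rV[R]_n -> sval Y}) (K : A).

(* Up to a projective summand of the source, f is the surjection (f, p). *)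
Definition cone_map : {linear (sval X * 'rV[R]_n)%type -> sval Y} :=
  hom_add (f \o fst) (p \o snd).

Variable i : {linear sval K -> (sval X * 'rV[R]_n)%type}.
Hypothesis p_surj : surjective p.
Hypothesis cone_exact : short_exact i cone_map.

Let fst_i : {linear sval K -> sval X} := fst \o i.

(** If f g is stably zero, it lifts through p as p r, and then (g, -r) takes values in the kernel of
    (f, p). *)
Lemma cone_weak_kernel : @weak_kernel A X Y (stable_pi f) K (stable_pi fst_i).
Proof.
have [inj_i icone _] := cone_exact.
have fi0 : pcomp (stable_pi f : phom X Y) (stable_pi fst_i : phom K X) = 0.
  rewrite pcompE stable_pi_eq0; exists 'rV[R]_n, (hom_opp (snd \o i)), p.
  split=> [|x]; first exact: projective_rV.
  have : cone_map (i x) = 0 by apply/icone; exists x.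
  by rewrite /= linearN => /eqP; rewrite addr_eq0 => /eqP.
move=> Z g; have [g' <-] := stable_pi_surj g.
split=> [|[h ->]]; last by rewrite pcompA fi0 pcomp0f.
rewrite pcompE stable_pi_eq0 => fg0.
have [r rE] := stably_zero_lift fg0 p_surj.
have [z|h hE] := lift_injection (h := pair_map g' (hom_opp r)) inj_i.
  have /icone[k kE] : cone_map (pair_map g' (hom_opp r) z) = 0.
    by rewrite /= linearN rE /= subrr.
  by exists k.
exists (stable_pi h); rewrite pcompE; congr stable_pi.
by apply: linear_ext => z; rewrite /fst_i /= hE.
Qed.

Lemma cone_extension m (u : {linear sval K -> 'rV[R]_m}) :
  exists v : {linear (sval X * 'rV[R]_n)%type -> 'rV[R]_m},
    forall k, v (i k) = u k.
Proof. by apply: ext1_rV cone_exact _; apply: C_ext1; exact: svalP. Qed.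

Lemma cone_factor (W : lmodType R)
    (g : {linear (sval X * 'rV[R]_n)%type -> W}) :
  (forall k, g (i k) = 0) ->
  exists h : {linear sval Y -> W}, forall x, h (cone_map x) = g x.
Proof.
have [_ icone sp] := cone_exact => gi.
by apply: descend_surjection sp _ => x /icone[k <-].
Qed.

(** If g composed with K -> X is stably zero, it factors through a free module. By Ext^1(Y, R) = 0
    the first factor K -> R^m extends to X * R^n; subtracting this extension from g gives a map that
    vanishes on K and so descends to Y. *)
Lemma cone_weak_cokernel : @weak_cokernel A K X (stable_pi fst_i) Y (stable_pi f).
Proof.
have fi0 : pcomp (stable_pi f : phom X Y) (stable_pi fst_i : phom K X) = 0.
  by apply/cone_weak_kernel; exists (pid K); rewrite pcompf1.
move=> Z g; have [g' <-] := stable_pi_surj g.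
split=> [|[h ->]]; last by rewrite -pcompA fi0 pcompf0.
rewrite pcompE stable_pi_eq0 => gi0.
have [m [q sq]] := free_cover (C_fg (svalP Z)).
have [u uE] := stably_zero_lift gi0 sq.
have [v vE] := cone_extension u.
have [k|h hE] := @cone_factor _ (hom_add (g' \o fst) (hom_opp (q \o v))).
  by rewrite /= vE uE /fst_i /= subrr.
exists (stable_pi h); rewrite pcompE; apply/stable_pi_eq.
exists 'rV[R]_m, (v \o pair_map idfun \0), q; split; first exact: projective_rV.
move=> x; have := hE (x, 0); rewrite /= linear0 addr0 => e.
by rewrite /= e opprB addrC subrK.
Qed.

End Cone.

Lemma cone_exists X Y (f : {linear sval X -> sval Y}) n
    (p : {linear 'rV[R]_n -> sval Y}) : surjective p ->
  exists (K : A) (i : {linear sval K -> (sval X * 'rV[R]_n)%type}),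
    short_exact i (cone_map f p).
Proof.
move=> sp.
have [K [i [inj_i ip]]] := kernel_exists (cone_map f p).
have ss : surjective (cone_map f p).
  by move=> y; have [v <-] := sp y; exists (0, v); rewrite /= linear0 add0r.
have CXn : C (sval X * 'rV[R]_n)%type.
  by apply: subcat_prod; [exact: svalP|exact: subcat_rV].
suff CK : C K by exists (exist _ K CK), i.
apply: (resolving_ker C_resolving (f := i) (g := cone_map f p)) => //.
- exact: fin_gen_inj inj_i (C_fg CXn).
- exact: C_fg.
- by apply: C_fg; exact: svalP.
- exact: svalP.
Qed.

Lemma stable_weak_kernel X Y (f : phom X Y) :
  exists W (k : phom W X), weak_kernel f k /\ weak_cokernel k f.
Proof.
have [f' <-] := stable_pi_surj f.
have [n [p sp]] := free_cover (C_fg (svalP Y)).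
have [K [i ip]] := cone_exists f' sp.
exists K, (stable_pi (fst \o i)).
by split; [exact: cone_weak_kernel sp ip|exact: cone_weak_cokernel sp ip].
Qed.

Lemma cosyzygy_is_weak_kernel :
  (forall V, C V -> exists (Q W : lmodType R) (i : {linear V -> Q})
    (p : {linear Q -> W}),
    [/\ fin_gen Q, projective Q, C W & short_exact i p]) ->
  forall X Y (f : phom X Y), exists W (d : phom Y W), weak_kernel d f.
Proof.
move=> cosyz X Y f; have [f' <-] := stable_pi_surj f.
have [n [p sp]] := free_cover (C_fg (svalP Y)).
have [K [i ip]] := cone_exists f' sp.
have [inj_i icone scone] := ip.
have [Q [W [j [q [fQ hQ CW [inj_j jq sq]]]]]] := cosyz _ (svalP K).
pose W' : A := exist _ W CW.
(* [cone_extension] has free targets, so j is extended through a split free cover r of Q, with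
   section s. *)
have [m [r sr]] := free_cover fQ.
have [s sE] := hQ _ _ r idfun sr.
have [v vE] := cone_extension ip (s \o j).
have vj k : r (v (i k)) = j k by rewrite vE /= sE.
have [|d dE'] := cone_factor ip (g := q \o (r \o v)).
  by move=> k; rewrite /= vj; apply/jq; exists k.
have dE x : d (cone_map f' p x) = q (r (v x)) by exact: dE'.
exists W', (stable_pi d : phom Y W') => Z g; have [g' <-] := stable_pi_surj g.
have df0 : pcomp (stable_pi d : phom Y W') (stable_pi f' : phom X Y) = 0.
  rewrite pcompE stable_pi_eq0; exists Q, (r \o (v \o pair_map idfun \0)), q.
  by split=> // x; rewrite -[RHS]dE /= linear0 addr0.
split=> [|[h ->]]; last by rewrite pcompA df0 pcomp0f.
rewrite pcompE stable_pi_eq0 => dg0.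
have [l lE] := stably_zero_lift dg0 sq.
(* t identifies X * R^n with the pullback of d and q. A map g with d g stably zero gives a point (g,
   l) of this pullback, hence a lift to X * R^n. *)
pose t : {linear (sval X * 'rV[R]_n)%type -> (sval Y * Q)%type} :=
  pair_map (cone_map f' p) (r \o v).
have inj_t : injective t.
  apply: raddf_inj => x [/icone[k <-]] /=; rewrite vj => jk0.
  by rewrite (_ : k = 0) ?linear0 //; apply: inj_j; rewrite jk0 linear0.
have [z|h hE] := lift_injection (h := pair_map g' l) inj_t.
  have [x xE] := scone (g' z).
  have /jq[k kE] : q (l z - r (v x)) = 0.
    by rewrite linearB lE -dE xE subrr.
  exists (x + i k); rewrite /t /= /pair_map /=.
  have ik0 : cone_map f' p (i k) = 0 by apply/icone; exists k.
  congr pair.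
    apply: etrans (linearD (cone_map f' p) x (i k)) _.
    by rewrite xE [X in _ + X]ik0 addr0.
  by rewrite !linearD /= vj kE addrC subrK.
exists (stable_pi (fst \o h)); rewrite pcompE; apply/stable_pi_eq.
exists 'rV[R]_n, (snd \o h), p; split; first exact: projective_rV.
by move=> z; have [e _] := hE z; rewrite /= -e /= addrAC subrr add0r.
Qed.

End StableCategory.

(** * Full embeddings and annihilators *)

Record full_embedding (A : preadditive) := FullEmbedding {
  fe_obj :> A -> A;
  fe_hom : forall X Y, phom X Y -> phom (fe_obj X) (fe_obj Y);
  fe_id : forall X, fe_hom (pid X) = pid (fe_obj X);
  fe_comp : forall X Y Z (g : phom Y Z) (f : phom X Y),
    fe_hom (pcomp g f) = pcomp (fe_hom g) (fe_hom f);
  fe_add : forall X Y (f g : phom X Y), fe_hom (f + g) = fe_hom f + fe_hom g;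
  fe_faithful : forall X Y (f : phom X Y), fe_hom f = 0 -> f = 0;
  fe_full : forall X Y (g : phom (fe_obj X) (fe_obj Y)), exists f, fe_hom f = g }.

Section FullEmbedding.
Variable A : preadditive.
Implicit Types (X Y Z : A) (F G : full_embedding A).

Lemma fe_zero F X Y : fe_hom F (0 : phom X Y) = 0.
Proof. by apply: (addrI (fe_hom F (0 : phom X Y))); rewrite -fe_add !addr0. Qed.

Lemma fe_sum F X Y (I : finType) (f : I -> phom X Y) :
  fe_hom F (\sum_i f i) = \sum_i fe_hom F (f i).
Proof. exact: (big_morph _ (@fe_add _ F X Y) (fe_zero F X Y)). Qed.

Lemma pcomp_suml X Y Z (I : finType) (g : I -> phom Y Z) (f : phom X Y) :
  pcomp (\sum_i g i) f = \sum_i pcomp (g i) f.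
Proof.
exact: (big_morph (fun g => pcomp g f) (fun g h => pcompDl g h f) (pcomp0f _ f)).
Qed.

Lemma pcomp_sumr X Y Z (I : finType) (g : phom Y Z) (f : I -> phom X Y) :
  pcomp g (\sum_i f i) = \sum_i pcomp g (f i).
Proof.
exact: (big_morph (fun f => pcomp g f) (fun f h => pcompDr g f h) (pcompf0 _ g)).
Qed.

Definition fe_identity : full_embedding A :=
  @FullEmbedding A id (fun X Y f => f) (fun X => erefl)
    (fun X Y Z g f => erefl) (fun X Y f g => erefl) (fun X Y f e => e)
    (fun X Y g => ex_intro _ g erefl).

Program Definition fe_compose F G : full_embedding A :=
  @FullEmbedding A (fun X => F (G X)) (fun X Y f => fe_hom F (fe_hom G f))
    _ _ _ _ _.
Next Obligation. by move=> F G X /=; rewrite !fe_id. Qed.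
Next Obligation. by move=> F G X Y Z g f /=; rewrite !fe_comp. Qed.
Next Obligation. by move=> F G X Y f g /=; rewrite !fe_add. Qed.
Next Obligation. by move=> F G X Y f /fe_faithful/fe_faithful. Qed.
Next Obligation.
move=> F G X Y g /=; have [f fE] := fe_full g; have [h hE] := fe_full f.
by exists h; rewrite hE.
Qed.

(* X is a direct summand of a finite power of M, up to splitting of
   idempotents. *)
Definition in_add (M X : A) : Prop :=
  exists (I : finType) (a : I -> phom X M) (b : I -> phom M X),
    \sum_i pcomp (b i) (a i) = pid X.

Definition additive_generator (M : A) : Prop := forall X, in_add M X.

(** The identities of X and Y are sums of maps through M, so f is a sum of terms d (a f b) c with a
    f b an endomorphism of M. The outer factors are kept because membership in an annihilator
    controls a f b only after composition with maps from, or to, the image of a functor. *)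
Lemma additive_generator_detects (M : A) X Y (f : phom X Y) :
  additive_generator M ->
  (forall (a : phom Y M) (b : phom M X) (c : phom X M) (d : phom M Y),
    pcomp d (pcomp (pcomp a (pcomp f b)) c) = 0) -> f = 0.
Proof.
move=> genM fab; have [I [a [b bX]]] := genM X; have [J [c [d dY]]] := genM Y.
rewrite -[f]pcomp1f -dY pcomp_suml big1 // => j _.
rewrite -[pcomp _ _]pcompf1 -bX pcomp_sumr big1 // => i _.
by have := fab (c j) (b i) (a i) (d j); rewrite -!pcompA.
Qed.

End FullEmbedding.

Section Detection.
Variables (R : comNzRingType) (C : lmodType R -> Prop).
Local Notation A := (stable_category C).
Implicit Types (X Y Z : A) (F G : full_embedding A).
Hypothesis R_noetherian : noetherian R.
Variable M : A.
Hypothesis M_fg : fin_gen (sval M).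
Hypothesis M_generator : additive_generator M.

Let fg_end := fin_gen_stable_hom R_noetherian M_fg M_fg.

Definition right_ann F : set (stable_hom (sval M) (sval M)) :=
  fun f => forall Z (g : phom (F Z) M), @pcomp A _ _ _ f g = 0.

Definition left_ann F : set (stable_hom (sval M) (sval M)) :=
  fun f => forall Z (g : phom M (F Z)), @pcomp A _ _ _ g f = 0.

Lemma right_ann_submod F : is_submod (right_ann F).
Proof.
split=> [Z g|a f f' fF f'F Z g]; first exact: (@pcomp0f A).
apply: etrans (@pcompDl A _ _ _ _ _ _) _.
by rewrite (@f'F Z g) addr0 pcompZl (fF Z g) scaler0.
Qed.

Lemma left_ann_submod F : is_submod (left_ann F).
Proof.
split=> [Z g|a f f' fF f'F Z g]; first exact: (@pcompf0 A).
apply: etrans (@pcompDr A _ _ _ _ _ _) _.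
by rewrite (@f'F Z g) addr0 pcompZr (fF Z g) scaler0.
Qed.

(* Choose G with the annihilator of its image maximal: composing G with F
   only shrinks the image, so the annihilators of G and of G \o F agree, and
   full faithfulness of G transports this back to F. *)
Lemma full_embedding_generates F X Y (f : phom X Y) :
  (forall Z (g : phom (F Z) X), pcomp f g = 0) -> f = 0.
Proof.
move=> fF.
have [||_ [G ->] maxG] :=
  @noetherian_maximal _ _ (fun S => exists G, S = right_ann G) R_noetherian fg_end.
- by move=> _ [G ->]; exact: right_ann_submod.
- by exists (right_ann (fe_identity A)), (fe_identity A).
have sub_GF : (right_ann (fe_compose G F) `<=` right_ann G)%classic.
  apply: maxG; first by exists (fe_compose G F).
  by move=> h hG Z g; apply: hG.
apply: (@fe_faithful _ G); apply: (additive_generator_detects M_generator).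
move=> a b c d.
suff /sub_GF ann : right_ann (fe_compose G F) (pcomp a (pcomp (fe_hom G f) b)).
  by rewrite [X in pcomp d X]ann pcompf0.
(* By fullness of G the map b g comes from some h : F Z -> X, and f h = 0 by assumption. *)
move=> Z g; have [h hE] := fe_full (pcomp b g : phom (G (F Z)) (G X)).
have fh : pcomp (fe_hom G f) (fe_hom G h) = 0 by rewrite -fe_comp fF fe_zero.
rewrite -!pcompA; apply: etrans (pcompf0 _ a); congr (pcomp a _).
by rewrite -[RHS]fh hE.
Qed.

(** Left annihilators also grow when the image of the functor shrinks, so the dual statement again
    uses an ascending chain in End(M). *)
Lemma full_embedding_cogenerates F X Y (f : phom X Y) :
  (forall Z (g : phom Y (F Z)), pcomp g f = 0) -> f = 0.
Proof.
move=> fF.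
have [||_ [G ->] maxG] :=
  @noetherian_maximal _ _ (fun S => exists G, S = left_ann G) R_noetherian fg_end.
- by move=> _ [G ->]; exact: left_ann_submod.
- by exists (left_ann (fe_identity A)), (fe_identity A).
have sub_GF : (left_ann (fe_compose G F) `<=` left_ann G)%classic.
  apply: maxG; first by exists (fe_compose G F).
  by move=> h hG Z g; apply: hG.
apply: (@fe_faithful _ G); apply: (additive_generator_detects M_generator).
move=> a b c d.
suff /sub_GF ann : left_ann (fe_compose G F) (pcomp a (pcomp (fe_hom G f) b)).
  by rewrite pcompA [X in pcomp X c]ann pcomp0f.
move=> Z g; have [h hE] := fe_full (pcomp g a : phom (G Y) (G (F Z))).
have hf : pcomp (fe_hom G h) (fe_hom G f) = 0 by rewrite -fe_comp fF fe_zero.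
rewrite !pcompA; apply: etrans (pcomp0f _ b); congr (pcomp _ b).
by rewrite -[RHS]hf hE.
Qed.

End Detection.

(** * The syzygy functor *)

Section Syzygy.
Variables (R : comNzRingType) (C : lmodType R -> Prop).
Local Notation A := (stable_category C).
Implicit Types X Y Z : A.
Hypothesis R_noetherian : noetherian R.
Hypothesis C_subcategory : subcategory C.
Hypothesis C_resolving : resolving C.
Hypothesis C_ext1 : forall V, C V -> ext1 V R^o.

Let C_fg := subcat_fg C_subcategory.
Let fg X : {V : lmodType R | fin_gen V} := exist _ (sval X) (C_fg (svalP X)).

Fact syzygy_in_C X : C (cover_ker (fg X)).
Proof.
apply: (resolving_ker C_resolving _ _ _ (cover_exact (fg X))).
- exact: cover_ker_fg.
- exact: fin_gen_rV.
- exact: svalP (fg X).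
- exact: subcat_rV.
- exact: svalP X.
Qed.

Definition syzygy X : A := exist _ _ (syzygy_in_C X).
Local Notation Om := syzygy.
Local Notation F X := 'rV[R]_(cover_size (fg X)).

Definition syzygy_incl X : {linear sval (Om X) -> F X} := cover_incl (fg X).
Definition syzygy_cover X : {linear F X -> sval X} := cover (fg X).
Local Notation i_ X := (syzygy_incl X).
Local Notation p_ X := (syzygy_cover X).

Lemma syzygy_exact X : short_exact (i_ X) (p_ X).
Proof. exact: cover_exact. Qed.

Lemma syzygy_cover_incl X k : p_ X (i_ X k) = 0.
Proof. by have [_ e _] := syzygy_exact X; apply/e; exists k. Qed.

(** A relation rather than a function: f' depends on the choice of the lift g between the covers and
    becomes determined by f only modulo stably zero maps. *)
Definition syzygy_map X Y (f : {linear sval X -> sval Y})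
    (f' : {linear sval (Om X) -> sval (Om Y)}) : Prop :=
  exists g : {linear F X -> F Y},
    (forall v, p_ Y (g v) = f (p_ X v)) /\ (forall k, g (i_ X k) = i_ Y (f' k)).

Lemma syzygy_map_exists X Y (f : {linear sval X -> sval Y}) :
  exists f', @syzygy_map X Y f f'.
Proof.
have [inj_Y iY sY] := syzygy_exact Y.
have [g gE] := @projective_rV _ _ _ _ (p_ Y) (f \o p_ X) sY.
have [k|f' f'E] := lift_injection (h := g \o i_ X) inj_Y.
  have /iY[l lE] : p_ Y (g (i_ X k)) = 0.
    by apply: etrans (gE _) _; 
    rewrite -[LHS]/(f (p_ X (i_ X k))) syzygy_cover_incl linear0.
  by exists l.
by exists f', g; split.
Qed.

(** Since Ext^1(X, R) = 0, a map of syzygies extends to the free covers and then induces a map on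
    the quotients. *)
Lemma syzygy_map_full X Y (f' : {linear sval (Om X) -> sval (Om Y)}) :
  exists f : {linear sval X -> sval Y}, syzygy_map f f'.
Proof.
have [_ iX sX] := syzygy_exact X.
have [g gE] := ext1_rV (C_ext1 (svalP X)) (syzygy_exact X) (i_ Y \o f').
have [v /iX[k <-]|f fE] := descend_surjection (h := p_ Y \o g) sX.
  rewrite -[LHS]/(p_ Y (g (i_ X k))) gE; exact: syzygy_cover_incl.
by exists f, g; split.
Qed.

(** Applied to differences, the forward direction makes the syzygy of a stable map well defined, and
    the converse makes the functor faithful. Forward: a lift l of f to the cover of Y corrects g to
    a map into the syzygy of Y that restricts to f'. Converse: by Ext^1(X, R) = 0 a factorization of
    f' through a free module extends to the cover of X; correcting g by it gives a map that descends
    to a lift of f. *)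
Lemma syzygy_map_stably_zero X Y (f : {linear sval X -> sval Y}) f' :
  syzygy_map f f' -> stably_zero f <-> stably_zero f'.
Proof.
have [inj_Y iY sY] := syzygy_exact Y; have [_ iX sX] := syzygy_exact X.
move=> [g [gf gf']]; split=> [f0|[P [u [v [hP fE]]]]].
  have [l lE] := stably_zero_lift f0 sY.
  have [w|h hE] := lift_injection (h := hom_add g (hom_opp (l \o p_ X))) inj_Y.
    have /iY[k kE] : p_ Y (g w - l (p_ X w)) = 0.
      by rewrite linearB gf lE subrr.
    by exists k.
  exists (F X), (i_ X), h; split=> [|k]; first exact: projective_rV.
  apply: inj_Y; apply: etrans (esym (hE _)).
  rewrite -[RHS]/(g (i_ X k) - l (p_ X (i_ X k))) gf'.
  by rewrite syzygy_cover_incl linear0 subr0.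
have [n [q sq]] := free_cover (C_fg (svalP (Om Y))).
have [u' u'E] := stably_zero_lift (ex_intro _ P (ex_intro _ u
  (ex_intro _ v (conj hP fE)))) sq.
have [w wE] := ext1_rV (C_ext1 (svalP X)) (syzygy_exact X) u'.
have [x /iX[k <-]|h hE] := descend_surjection
    (h := hom_add g (hom_opp (i_ Y \o (q \o w)))) sX.
  rewrite -[LHS]/(g (i_ X k) - i_ Y (q (w (i_ X k)))) wE u'E gf'.
  by rewrite subrr.
exists (F Y), h, (p_ Y); split=> [|x]; first exact: projective_rV.
have [v' <-] := sX x; rewrite hE.
rewrite -[hom_add _ _ v']/(g v' - i_ Y (q (w v'))) linearB gf.
by rewrite syzygy_cover_incl subr0.
Qed.

Lemma syzygy_mapB X Y (f g : {linear sval X -> sval Y}) f' g' :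
  syzygy_map f f' -> syzygy_map g g' ->
  @syzygy_map X Y (f - g) (f' - g').
Proof.
move=> [h [hf hf']] [l [lg lg']]; exists (h - l).
split=> v; first by rewrite -[LHS]/(p_ Y (h v - l v)) linearB hf lg.
by rewrite -[RHS]/(i_ Y (f' v - g' v)) linearB -hf' -lg'.
Qed.

Lemma syzygy_mapD X Y (f g : {linear sval X -> sval Y}) f' g' :
  syzygy_map f f' -> syzygy_map g g' ->
  @syzygy_map X Y (f + g) (f' + g').
Proof.
move=> [h [hf hf']] [l [lg lg']]; exists (h + l).
split=> v; first by rewrite -[LHS]/(p_ Y (h v + l v)) linearD hf lg.
by rewrite -[RHS]/(i_ Y (f' v + g' v)) linearD -hf' -lg'.
Qed.

Lemma syzygy_map_id X : @syzygy_map X X idfun idfun.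
Proof. by exists idfun. Qed.

Lemma syzygy_map_comp X Y Z (g : {linear sval Y -> sval Z})
    (f : {linear sval X -> sval Y}) g' f' :
  syzygy_map g g' -> syzygy_map f f' -> @syzygy_map X Z (g \o f) (g' \o f').
Proof.
move=> [k [kg kg']] [h [hf hf']]; exists (k \o h).
split=> v; first by rewrite -[LHS]/(p_ Z (k (h v))) kg hf.
by rewrite -[LHS]/(k (h (i_ X v))) hf' kg'.
Qed.

Definition syzygy_hom X Y (f : phom X Y) : phom (Om X) (Om Y) :=
  stable_pi (sval (boolp.cid (@syzygy_map_exists X Y (repr f)))).

Lemma syzygy_homE X Y (f : {linear sval X -> sval Y}) f' :
  syzygy_map f f' -> @syzygy_hom X Y (stable_pi f) = stable_pi f'.
Proof.
move=> ff'; rewrite /syzygy_hom; case: boolp.cid => g' /= gg'.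
apply/stable_pi_eq; apply/(syzygy_map_stably_zero (syzygy_mapB gg' ff')).
by apply/stable_pi_eq; rewrite /stable_pi /lmod_pi reprK.
Qed.

Lemma syzygy_hom_rep X Y (f : phom X Y) : exists f0 f',
  [/\ f = stable_pi f0, syzygy_map f0 f' & syzygy_hom f = stable_pi f'].
Proof.
have [f0 <-] := stable_pi_surj f; have [f' ff'] := syzygy_map_exists f0.
by exists f0, f'; split=> //; apply: syzygy_homE.
Qed.

Program Definition syzygy_embedding : full_embedding A :=
  @FullEmbedding A Om syzygy_hom _ _ _ _ _.
Next Obligation. by move=> X; apply: syzygy_homE; apply: syzygy_map_id. Qed.
Next Obligation.
move=> X Y Z g f; have [g0 [g' [-> gg' ->]]] := syzygy_hom_rep g.
have [f0 [f' [-> ff' ->]]] := syzygy_hom_rep f.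
by rewrite !pcompE; apply: syzygy_homE; apply: syzygy_map_comp.
Qed.
Next Obligation.
move=> X Y f g; have [f0 [f' [-> ff' ->]]] := syzygy_hom_rep f.
have [g0 [g' [-> gg' ->]]] := syzygy_hom_rep g.
rewrite -[RHS]stable_piD -[in LHS]stable_piD; apply: syzygy_homE.
exact: syzygy_mapD.
Qed.
Next Obligation.
move=> X Y f; have [f0 [f' [-> ff' ->]]] := syzygy_hom_rep f.
by move=> /stable_pi_eq0/(syzygy_map_stably_zero ff')/stable_pi_eq0.
Qed.
Next Obligation.
move=> X Y g; have [f' <-] := stable_pi_surj g.
have [f ff'] := syzygy_map_full f'.
by exists (stable_pi f); apply: syzygy_homE.
Qed.

Local Notation E := syzygy_embedding.

(** N is a sum of copies of M, one for each generator of the module of stable maps Om M -> Y, plus a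
    starting copy that carries the zero map. Applying the functor to the biproduct maps keeps the
    source of the form E N. Maps from other syzygies reduce to this case because every Z is a
    summand of a power of M. *)
Lemma syzygy_approximation (M Y : A) : additive_generator M ->
  exists N (g : phom (E N) Y), forall Z (h : phom (E Z) Y),
    exists l, h = pcomp g l.
Proof.
move=> genM.
have [n [e eE]] : fin_gen (stable_hom (sval (Om M)) (sval Y)).
  by apply: fin_gen_stable_hom => //; apply: C_fg; exact: svalP.
have [N [g gP]] : exists N (g : phom (E N) Y),
    forall j, exists l : phom (E M) (Om N), e j = pcomp g l.
  elim: n e {eE} => [|n IHn] e.
    by exists M, 0 => -[].
  have [N [g gP]] := IHn (fun j => e (lift ord0 j)).
  have [S [i [j [p [q [pi qj qi pj _]]]]]] := stable_biproduct C_subcategory N M.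
  exists S, (pcomp g (fe_hom E p)
             + pcomp (e ord0 : phom (E M) Y) (fe_hom E q)) => k.
  case: (unliftP ord0 k) => [k'|] ->.
    have [l lE] := gP k'.
    exists (pcomp (fe_hom E i) l).
    rewrite pcompDl -!pcompA !(pcompA (fe_hom _ _)) -!fe_comp pi qi.
    by rewrite fe_id fe_zero pcomp1f pcomp0f pcompf0 addr0.
  exists (fe_hom E j).
  rewrite pcompDl -!pcompA -!fe_comp qj pj.
  by rewrite fe_id fe_zero pcompf1 pcompf0 add0r.
exists N, g.
have gM (h : phom (E M) Y) : exists l, h = pcomp g l.
  have [c ->] := eE h; have /choice[l lE] := gP.
  exists (\sum_j (c j *: (l j : stable_hom _ _))).
  apply: etrans (esym (pcomp_sumr _ _)); apply: eq_bigr => j _.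
  by rewrite pcompZr -lE.
move=> Z h; have [I [a [b bZ]]] := genM Z.
have /choice[l lE] (i : I) := gM (pcomp h (fe_hom E (b i))).
exists (\sum_i pcomp (l i) (fe_hom E (a i))).
rewrite pcomp_sumr -[h in LHS]pcompf1.
rewrite -[pid (E Z)](@fe_id _ E) -bZ fe_sum pcomp_sumr.
by apply: eq_bigr => i _; rewrite fe_comp !pcompA lE.
Qed.

End Syzygy.

(** * Cosyzygies *)

Section Cokernel.
Variables (R : comNzRingType) (U V : lmodType R) (f : {linear U -> V}).

Definition image_pred : pred V := fun y => `[< exists x, f x = y >].
Fact image_pred_submod : submod_closed image_pred.
Proof.
split=> [|a _ _ /asboolP[x <-] /asboolP[y <-]]; apply/asboolP.
  by exists 0; rewrite linear0.
by exists (a *: x + y); rewrite linearP.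
Qed.

Lemma cokernel_exists : exists (W : lmodType R) (q : {linear V -> W}),
  surjective q /\ exact_at f q.
Proof.
have [|q qE] := @linear_map_of R V (lmod_quot image_pred_submod)
    (@lmod_pi _ _ _ image_pred_submod).
  by move=> a x y; rewrite lmod_piD -(lmod_quot_scaleE image_pred_submod).
exists (lmod_quot image_pred_submod), q; split=> [z|y].
  by have [x <-] := lmod_pi_surj z; exists x.
rewrite -(linear0 q) !qE lmod_pi_eq subr0.
by split=> [/asboolP|h]; last exact/asboolP.
Qed.

End Cokernel.

Section Cosyzygy.
Variables (R : comNzRingType) (C : lmodType R -> Prop).
Local Notation A := (stable_category C).
Implicit Types X Y Z : A.
Hypothesis R_noetherian : noetherian R.
Hypothesis C_subcategory : subcategory C.
Hypothesis C_resolving : resolving C.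
Hypothesis C_ext1 : forall V, C V -> ext1 V R^o.

Let C_fg := subcat_fg C_subcategory.
Local Notation E := (syzygy_embedding R_noetherian C_subcategory C_resolving C_ext1).

Variable M : A.
Hypothesis M_generator : additive_generator M.

(* Let g : E N -> X be a right approximation by syzygies. It is epi because
   syzygies generate. In the cone sequence K -> E N -> X, every map from K to a
   syzygy extends to E N: the obstruction is a map on X that g annihilates.
   As syzygies cogenerate, the weak kernel of K -> E N is zero, so K -> E N
   splits, and hence so does g. *)
Lemma syzygy_retract X :
  exists N (s : phom X (E N)) (g : phom (E N) X), pcomp g s = pid X.
Proof.
have [N [g gP]] := syzygy_approximation R_noetherian C_subcategory C_resolving
  C_ext1 X M_generator.
have epi_g Y (f : phom X Y) : pcomp f g = 0 -> f = 0.
  move=> fg; apply: (full_embedding_generates R_noetherian (C_fg (svalP M))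
    M_generator (F := E)) => Z h.
  by have [l ->] := gP _ h; rewrite pcompA fg pcomp0f.
have [g0 g0E] := stable_pi_surj g.
have [n [p sp]] := free_cover (C_fg (svalP X)).
have [K [i ip]] := cone_exists R_noetherian C_subcategory C_resolving g0 sp.
have := cone_weak_kernel sp ip.
have := cone_weak_cokernel C_subcategory C_ext1 sp ip.
set k : phom K (E N) := stable_pi _; rewrite g0E => kco kker.
have [inj_i icone scone] := ip.
have extends Z (h : phom K (E Z)) : exists h', h = pcomp h' k.
  have [h0 <-] := stable_pi_surj h.
  pose i_Z := syzygy_incl R_noetherian C_subcategory C_resolving Z.
  pose p_Z := syzygy_cover C_subcategory Z.
  have [inj_Z iZ sZ] : short_exact i_Z p_Z by apply: syzygy_exact.
  have [v vE] := cone_extension C_ext1 ip (i_Z \o h0).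
  have [l|e eE] := cone_factor ip (g := p_Z \o v).
    by rewrite -[LHS]/(p_Z (v (i l))) vE; apply/iZ; eexists.
  have /epi_g e0 : pcomp (stable_pi e : phom X Z) g = 0.
    rewrite -g0E pcompE stable_pi_eq0.
    exists 'rV[R]_(cover_size _), (v \o pair_map idfun \0), p_Z.
    split=> [|x]; first exact: projective_rV.
    have := eE (x, 0); rewrite -[cone_map _ _ _]/(g0 x + p 0) linear0 addr0.
    exact.
  (* As the obstruction e is stably zero, it lifts to r : X -> R^m, the free cover of Z. Subtracting
     r composed with the cone map does not change v on K and moves its values into the syzygy of
     Z. *)
  have [r rE] := stably_zero_lift (iffLR (stable_pi_eq0 _) e0) sZ.
  have [x|w wE] := lift_injection (h := hom_add v (hom_opp (r \o cone_map g0 p)))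
      inj_Z.
    have /iZ[z zE] : p_Z (v x - r (cone_map g0 p x)) = 0.
      by rewrite linearB rE eE subrr.
    by exists z.
  exists (stable_pi (w \o pair_map idfun \0)).
  rewrite pcompE; apply/stable_pi_eq.
  exists 'rV[R]_n, (snd \o i), (w \o pair_map \0 idfun).
  split=> [|x]; first exact: projective_rV.
  have h0E : w (i x) = h0 x.
    apply: inj_Z; rewrite wE.
    rewrite -[LHS]/(v (i x) - r (cone_map g0 p (i x))) vE.
    have c0 : cone_map g0 p (i x) = 0 by apply/icone; exists x.
    by rewrite c0 linear0 subr0.
  rewrite -[LHS]/(h0 x - w ((i x).1, 0)) -h0E -linearB.
  rewrite -[RHS]/(w (0, (i x).2)); congr (w _).
  by case: (i x) => a b; congr pair; rewrite /= ?subrr ?subr0.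
have [W [d [dker dco]]] := stable_weak_kernel R_noetherian C_subcategory
  C_resolving C_ext1 k.
have kd : pcomp k d = 0 by apply/dker; exists (pid _); rewrite pcompf1.
have d0 : d = 0.
  apply: (full_embedding_cogenerates R_noetherian (C_fg (svalP M))
    M_generator (F := E)) => Z h.
  by have [l ->] := extends _ h; rewrite -pcompA kd pcompf0.
have /dco[r rE] : pcomp (pid K) d = 0 by rewrite d0 pcompf0.
(* The idempotent 1 - k r kills k, so it equals s g. Then g s g = g (1 - k r) = g because g k = 0,
   and g s = 1 because g is epi. *)
have /kco[s sE] : pcomp (pid _ - pcomp k r) k = 0.
  by rewrite pcompBl pcomp1f -pcompA -rE pcompf1 subrr.
have gk : pcomp g k = 0 by apply/kker; exists (pid _); rewrite pcompf1.
exists N, s, g; apply/eqP; rewrite -subr_eq0; apply/eqP/epi_g.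
rewrite pcompBl -pcompA -sE pcompBr pcompA gk pcomp0f pcompf1 subr0 pcomp1f.
by rewrite subrr.
Qed.

(* V is a summand of some B = L * R^n, with L the syzygy of N and complement K.
   Embed V in Q = R^m * R^n through B: then Q / V is an extension of
   Q / B = N by B / V = K. *)
Lemma cosyzygy_exists V : C V -> exists (Q W : lmodType R) (j : {linear V -> Q})
    (q : {linear Q -> W}),
  [/\ fin_gen Q, projective Q, C W & short_exact j q].
Proof.
move=> CV; pose X : A := exist _ V CV.
have [N [s' [g' gs]]] := syzygy_retract X.
have [s sE] := stable_pi_surj s'; have [g gE] := stable_pi_surj g'.
pose L : lmodType R := sval (E N).
have [m [i_N [p_N [inj_N iN sN]]]] : exists m (i : {linear L -> 'rV[R]_m})
    (p : {linear 'rV[R]_m -> sval N}), short_exact i p.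
  by do 3!eexists; apply: syzygy_exact.
have [n [c sc]] := free_cover (C_fg CV).
(* g s is the identity only stably. The difference 1 - g s lifts through the free cover c as c l,
   which makes V an honest summand of L * R^n. *)
have /stable_pi_eq/stably_zero_lift/(_ sc)[l lE] :
    stable_pi (idfun : {linear V -> V}) = stable_pi (g \o s : {linear V -> V}).
  by rewrite -[LHS]gs -sE -gE pcompE.
pose B : lmodType R := (L * 'rV[R]_n)%type.
pose sg : {linear V -> B} := pair_map s l.
pose gm : {linear B -> V} := hom_add (g \o fst) (c \o snd).
have gmsg x : gm (sg x) = x.
  by rewrite -[LHS]/(g (s x) + c (l x)) lE addrC -[LHS]/(x - g (s x) + g (s x)) subrK.
pose Q : lmodType R := ('rV[R]_m * 'rV[R]_n)%type.
pose t : {linear B -> Q} := pair_map (i_N \o fst) snd.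
have inj_t : injective t.
  move=> [x1 x2] [y1 y2] e; have [e1 e2] : i_N x1 = i_N y1 /\ x2 = y2.
    by case: e.
  by rewrite e2 (inj_N _ _ e1).
pose j : {linear V -> Q} := t \o sg.
have inj_j : injective j.
  by move=> x y /inj_t e; rewrite -[x]gmsg e gmsg.
have [W [q [sq jq]]] := cokernel_exists j.
have fQ : fin_gen Q by apply: fin_gen_prod; apply: fin_gen_rV.
have hQ : projective Q by apply: projective_prod; apply: projective_rV.
exists Q, W, j, q; split=> //.
have [K [i [inj_i iK]]] := kernel_exists gm.
have CB : C B by apply: (subcat_prod C_subcategory); [exact: svalP (E N)|exact: subcat_rV].
have fK : fin_gen K by apply: fin_gen_inj inj_i (C_fg CB).
have CK : C K.
  suff /(subcat_sum C_subcategory (C_fg CV) fK)[] : C (V * K)%type by [].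
  apply: (subcat_iso C_subcategory) CB.
  have [z|k kE] := lift_injection (h := hom_add idfun (hom_opp (sg \o gm))) inj_i.
    have /iK[y yE] : gm (z - sg (gm z)) = 0 by rewrite linearB gmsg subrr.
    by exists y.
  have kE' z : i (k z) = z - sg (gm z) by exact: kE.
  exists (pair_map gm k); exists (fun u => sg u.1 + i u.2).
    by move=> z; rewrite -[LHS]/(sg (gm z) + i (k z)) kE' addrC subrK.
  move=> [x y]; rewrite /= /pair_map.
  have gmi : gm (i y) = 0 by apply/iK; exists y.
  have e : gm (sg x + i y) = x by rewrite linearD gmsg gmi addr0.
  by congr pair => //; apply: inj_i; rewrite kE' e addrC addKr.
have [x|r rE] := descend_surjection (h := p_N \o fst) sq.
  by move=> /jq[v <-]; apply/iN; eexists.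
have rE' f v : r (q (f, v)) = p_N f by exact: rE.
apply: (resolving_ext C_resolving (f := q \o (t \o i)) (g := r)) CK (svalP N) => //.
- exact: fin_gen_surj sq fQ.
- exact: C_fg (svalP N).
split.
- apply: raddf_inj => k /jq[v] /inj_t e.
  have v0 : v = 0 by rewrite -[v]gmsg e; apply/iK; exists k.
  by apply: inj_i; rewrite linear0 -e v0 linear0.
- move=> w; split=> [|[k <-]]; last first.
    by apply: etrans (rE' _ _) _; apply/iN; eexists.
  have [[f v] <-] := sq w; rewrite rE' => /iN[z zE].
  have /iK[k kE] : gm ((z, v) - sg (gm (z, v))) = 0 by rewrite linearB gmsg subrr.
  exists k; rewrite -[LHS]/(q (t (i k))) kE !linearB.
  have -> : q (t (sg (gm (z, v)))) = 0 by apply/jq; eexists.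
  by rewrite subr0; congr (q _); rewrite -zE.
- move=> y; have [f fE] := sN y; exists (q (f, 0)); by rewrite rE'.
Qed.

End Cosyzygy.

(** * Additive generators from finite type *)

Section FiniteType.
Variables (R : comNzRingType) (C : lmodType R -> Prop).
Local Notation A := (stable_category C).
Implicit Types X Y Z M : A.
Hypothesis R_noetherian : noetherian R.
Hypothesis C_subcategory : subcategory C.

Let C_fg := subcat_fg C_subcategory.

Lemma in_add_sum M X Y Z (i : phom Y X) (p : phom X Y) (j : phom Z X)
    (q : phom X Z) :
  pcomp i p + pcomp j q = pid X -> in_add M Y -> in_add M Z -> in_add M X.
Proof.
move=> ijX [I [a [b bY]]] [J [c [d dZ]]].
exists (I + J)%type.
exists (fun u => match u with inl k => pcomp (a k) p | inr k => pcomp (c k) q end).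
exists (fun u => match u with inl k => pcomp i (b k) | inr k => pcomp j (d k) end).
rewrite -ijX big_sumType -[p in RHS]pcomp1f -[q in RHS]pcomp1f -bY -dZ.
rewrite !pcomp_suml !pcomp_sumr.
by congr (_ + _); apply: eq_bigr => k _; rewrite !pcompA.
Qed.

Lemma in_add_retract M M' X (i : phom M M') (p : phom M' M) :
  pcomp p i = pid M -> in_add M X -> in_add M' X.
Proof.
move=> piM [I [a [b bX]]].
exists I, (fun k => pcomp i (a k)), (fun k => pcomp (b k) p).
rewrite -bX; apply: eq_bigr => k _.
by rewrite -pcompA (pcompA p) piM pcomp1f.
Qed.

Lemma in_add_refl M : in_add M M.
Proof.
by exists 'I_1, (fun=> pid M), (fun=> pid M); rewrite big_ord1 pcomp1f.
Qed.

Lemma in_add_zero M X : zero_mod (sval X) -> in_add M X.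
Proof.
move=> X0; exists void, (of_void _), (of_void _).
rewrite big1 //; apply/esym/stable_pi_eq0; exists 'rV[R]_0, \0, \0.
by split=> [|x]; [exact: projective_rV|rewrite [LHS]X0].
Qed.

Lemma in_add_iso_prod M X Y Z : iso_mod (sval X) (sval Y * sval Z)%type ->
  in_add M Y -> in_add M Z -> in_add M X.
Proof.
move=> [f [g fK gK]].
have [h hE] : exists h : {linear (sval Y * sval Z)%type -> sval X},
    forall u, h u = g u.
  apply: linear_map_of => a u v; apply: (can_inj fK).
  by rewrite linearP !gK.
apply: (@in_add_sum _ X Y Z (stable_pi (h \o pair_map idfun \0))
  (stable_pi (fst \o f)) (stable_pi (h \o pair_map \0 idfun)) (stable_pi (snd \o f))).
rewrite !pcompE; apply: etrans (esym (stable_piD _ _)) _; congr stable_pi.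
apply: linear_ext => x.
rewrite -[LHS]/(h ((f x).1, 0) + h (0, (f x).2)) -linearD hE -[RHS]fK.
by congr g; case: (f x) => y z; congr pair; rewrite /= ?addr0 ?add0r.
Qed.

Lemma in_add_iso M X Y : iso_mod (sval X) (sval Y) -> in_add M Y -> in_add M X.
Proof.
move=> [f [g fK gK]] hY.
have [h hE] : exists h : {linear sval Y -> sval X}, forall u, h u = g u.
  by apply: linear_map_of => a u v; apply: (can_inj fK); rewrite linearP !gK.
(* The identity of X factors through Y alone; the second summand is Y again, with zero maps. *)
apply: (@in_add_sum _ X Y Y (stable_pi h) (stable_pi f) 0 0) => //.
rewrite pcompE pcomp0f addr0; congr stable_pi.
by apply: linear_ext => x; rewrite -[RHS]fK /= hE.
Qed.

Lemma in_add_family n (E : 'I_n -> lmodType R) : exists M, forall i (CE : C (E i)),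
  in_add M (exist _ (E i) CE).
Proof.
elim: n E => [|n IHn] E.
  by exists (exist _ _ (subcat_rV C_subcategory 0)) => -[].
have [M hM] := IHn (fun i => E (lift ord0 i)).
have [C0|nC0] := pselect (C (E ord0)); last first.
  exists M => i; case: (unliftP ord0 i) => [j|] -> CE; first exact: hM.
  by case: nC0.
have [S [i [j [p [q [pi qj _ _ _]]]]]] :=
  stable_biproduct C_subcategory M (exist _ (E ord0) C0).
exists S => k; case: (unliftP ord0 k) => [l|] -> CE.
  exact: in_add_retract pi (hM _ _).
apply: in_add_retract qj _.
by rewrite (Prop_irrelevance CE C0); apply: in_add_refl.
Qed.

(* If X0 is not in add M, take a quotient of X0 in C outside add M with maximal
   kernel: it is decomposable, and a proper summand is again outside add M. *)
Lemma indecomposables_generate M :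
  (forall X, indecomposable C (sval X) -> in_add M X) -> additive_generator M.
Proof.
move=> indM X0; apply: contrapT => badX0.
pose F (S : set (sval X0)) := exists Y, ~ in_add M Y /\
  exists2 q : {linear sval X0 -> sval Y}, surjective q & S = [set x | q x = 0]%classic.
have [||_ [Y [badY [q sq ->]]] maxY] :=
  @noetherian_maximal _ _ F R_noetherian (C_fg (svalP X0)).
- move=> _ [Y [_ [q _ ->]]]; split=> /= [|a x y /= qx qy].
    exact: linear0.
  by rewrite linearP qx qy scaler0 addr0.
- by exists [set x | x = 0]%classic, X0; split=> //; exists idfun => // x; exists x.
apply: (badY); apply: indM; split; first exact: svalP.
  by move=> /(in_add_zero M).
move=> U V CU CV isoY; pose U' : A := exist _ U CU; pose V' : A := exist _ V CV.
have [f [g fK gK]] := isoY.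
have [goodU|badU] := pselect (in_add M U').
  have [goodV|badV] := pselect (in_add M V').
    by case: badY; apply: (@in_add_iso_prod _ Y U' V').
  (* V is a bad quotient of X0 whose kernel contains that of q. By maximality the kernels agree, so
     the part U killed by the projection to V is zero. *)
  left=> u; have [x xE] := sq (g (u, 0)).
  suff : q x = 0 by rewrite xE => e; have := gK (u, 0); rewrite e linear0 => -[].
  apply: (maxY [set x | (f (q x)).2 = 0]%classic) => [|z /= ->|/=].
  - exists V'; split=> //; exists (snd \o (f \o q)) => // v.
    by have [y yE] := sq (g (0, v)); exists y; rewrite /= yE gK.
  - by rewrite linear0.
  - by rewrite xE gK.
right=> v; have [x xE] := sq (g (0, v)).
suff : q x = 0 by rewrite xE => e; have := gK (0, v); rewrite e linear0 => -[].
apply: (maxY [set x | (f (q x)).1 = 0]%classic) => [|z /= ->|/=].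
- exists U'; split=> //; exists (fst \o (f \o q)) => // u.
  by have [y yE] := sq (g (u, 0)); exists y; rewrite /= yE gK.
- by rewrite linear0.
- by rewrite xE gK.
Qed.

Lemma additive_generator_exists :
  finite_type C -> exists M, additive_generator M.
Proof.
move=> [n [E hE]]; have [M hM] := in_add_family E.
exists M; apply: indecomposables_generate => X indX.
have [i isoX] := hE _ indX; have [CX _ _] := indX.
have CE := subcat_iso C_subcategory isoX CX.
exact: (@in_add_iso _ _ (exist _ (E i) CE)).
Qed.

End FiniteType.

(** * Vanishing of higher extension groups *)

Section DimensionShift.
Variable R : comNzRingType.
Implicit Types K L N P T Y : lmodType R.

(** Retracts in the stable category of all modules: the kernels met in an arbitrary projective
    resolution need be neither finitely generated nor in [C]. *)
Definition stable_retract L T : Prop :=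
  exists (a : {linear L -> T}) (b : {linear T -> L}),
    stably_zero ((b \o a : {linear L -> L}) - (idfun : {linear L -> L})).

Lemma stable_retract_refl T : stable_retract T T.
Proof.
exists idfun, idfun, 'rV[R]_0, \0, \0; split=> [|x]; first exact: projective_rV.
exact: subrr.
Qed.

(** The extension Y of L is pulled back along b : T -> L, and f is extended over the pullback Y'. It
    remains to map Y to Y' compatibly with the inclusions of K. *)
Lemma ext1_stable_retract L T N : stable_retract L T -> ext1 T N -> ext1 L N.
Proof.
move=> [a [b [P [u [v [hP abE]]]]]] ext K Y i p [inj_i ip sp] f.
have [v' v'E] := hP _ _ p v sp.
have [Y' [j [inj_j jE]]] :=
  kernel_exists (hom_add (p \o fst) (hom_opp (b \o snd)) : {linear (Y * T)%type -> L}).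
have jE' y t : p y = b t <-> exists x, j x = (y, t).
  rewrite -jE /=; split=> [->|/eqP]; first by rewrite subrr.
  by rewrite subr_eq0 => /eqP.
have pj x : p (j x).1 = b (j x).2 by apply/jE'; exists x; case: (j x).
have [k|i' i'E] := lift_injection (h := pair_map i \0 : {linear K -> (Y * T)%type}) inj_j.
  by apply/jE'; rewrite linear0; apply/ip; exists k.
have [|g gE] := ext K Y' i' (snd \o j) _ f.
  split.
  - move=> k l e; apply: inj_i; have := congr1 j e; rewrite !i'E /= /pair_map.
    by case.
  - move=> x; split=> [/= e|[k <-]]; last by rewrite /= i'E.
    have /ip[k kE] : p (j x).1 = 0 by rewrite pj e linear0.
    exists k; apply: inj_j; rewrite i'E /= /pair_map kE /= -e.
    by case: (j x).
  - move=> t; have [y yE] := sp (b t); have /jE'[x xE] := yE.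
    by exists x; rewrite /= xE.
(* The naive pair (y, a (p y)) misses the pullback by the stably zero error b a - 1 = v u. Lifting v
   through p to v' corrects the first component, by a term that vanishes on K. *)
have [y|h hE] := lift_injection
    (h := pair_map (hom_add idfun (v' \o (u \o p))) (a \o p) : {linear Y -> (Y * T)%type})
    inj_j.
  apply/jE'; rewrite linearD /= v'E -abE.
  by rewrite -[X in _ + X]/(b (a (p y)) - p y) addrC subrK.
exists (g \o h) => k; rewrite -gE; apply: etrans (congr1 g _) _; last by [].
apply: inj_j; rewrite hE i'E /= /pair_map /=.
have -> : p (i k) = 0 by apply/ip; exists k.
by rewrite !linear0 addr0.
Qed.

(** Lift a and b to maps c, d of the covers. Then d c - 1, corrected by a lift of the stably zero
    error on L, takes values in K; this map t : P -> K restricts on K to the error d' c' - 1, which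
    therefore factors through P. *)
Lemma stable_retract_kernel L T K P K' P' (i : {linear K -> P})
    (p : {linear P -> L}) (i' : {linear K' -> P'}) (p' : {linear P' -> T}) :
  short_exact i p -> projective P -> short_exact i' p' -> projective P' ->
  stable_retract L T -> stable_retract K K'.
Proof.
move=> [inj_i ip sp] hP [inj_i' ip' sp'] hP' [a [b [Q [u [v [hQ abE]]]]]].
have [v' v'E] := hQ _ _ p v sp.
have [c cE] := hP _ _ p' (a \o p) sp'; have [d dE] := hP' _ _ p (b \o p') sp.
have pi k : p (i k) = 0 by apply/ip; exists k.
have pi' k : p' (i' k) = 0 by apply/ip'; exists k.
have [k|c' c'E] := lift_injection (h := c \o i) inj_i'.
  by apply/ip'; rewrite -[LHS]/(p' (c (i k))) cE /= pi linear0.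
have [k|d' d'E] := lift_injection (h := d \o i') inj_i.
  by apply/ip; rewrite -[LHS]/(p (d (i' k))) dE /= pi' linear0.
have [x|t tE] := lift_injection
    (h := hom_add (d \o c) (hom_opp (hom_add idfun (v' \o (u \o p))))) inj_i.
  apply/ip; rewrite -[hom_add _ _ x]/(d (c x) - (x + v' (u (p x)))).
  rewrite linearB linearD dE /= cE v'E -abE.
  by rewrite -[X in _ - (_ + X)]/(b (a (p x)) - p x) addrCA subrr addr0 subrr.
exists c', d', P, i, t; split=> // k; apply: inj_i.
rewrite tE -[LHS]/(i (d' (c' k) - k)) linearB d'E /= c'E /=.
by rewrite pi !linear0 addr0.
Qed.

Lemma ext_vanishes1 T N : ext1 T N -> ext_vanishes 1 T N.
Proof.
move=> ext Q f fd; have [K [i [inj_i iE]]] := kernel_exists (res_aug Q).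
have exQ := @res_exact0 _ _ Q.
have [x|d dE] := lift_injection (h := res_d Q 0) inj_i.
  by apply/iE/exQ; exists x.
have sd : surjective d.
  move=> k; have /exQ[x xE] : res_aug Q (i k) = 0 by apply/iE; exists k.
  by exists x; apply: inj_i; rewrite dE.
have [x dx0|h hE] := descend_surjection (h := f) sd.
  have /(@res_exact _ _ Q)[y <-] : res_d Q 0 x = 0 by rewrite -dE dx0 linear0.
  exact: fd.
have [|g gE] := ext _ _ i (res_aug Q) _ h.
  by split=> //; apply: res_aug_surj.
by exists g => x; rewrite -hE -gE dE.
Qed.

(** Truncating a resolution of T gives one of the kernel of its augmentation. The resolution is
    arbitrary, so the hypothesis has to cover kernels of all projective covers. *)
Lemma ext_vanishes_kernel n T N :
  (forall K P (i : {linear K -> P}) (p : {linear P -> T}), short_exact i p ->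
    projective P -> ext_vanishes n.+1 K N) ->
  ext_vanishes n.+2 T N.
Proof.
move=> van Q f fd; have [K [i [inj_i iE]]] := kernel_exists (res_aug Q).
have exQ := @res_exact0 _ _ Q.
have [x|d dE] := lift_injection (h := res_d Q 0) inj_i.
  by apply/iE/exQ; exists x.
have sd : surjective d.
  move=> k; have /exQ[x xE] : res_aug Q (i k) = 0 by apply/iE; exists k.
  by exists x; apply: inj_i; rewrite dE.
have exd : exact_at (res_d Q 1) d.
  move=> x; rewrite -(@res_exact _ _ Q) -dE; split=> [->|e].
    by rewrite linear0.
  by apply: inj_i; rewrite e linear0.
pose Q' : proj_resolution K := @ProjResolution _ _ (fun j => res_obj Q j.+1)
  (fun j => res_d Q j.+1) d (fun j => @res_projective _ _ Q j.+1)
  (fun j => @res_exact _ _ Q j.+1) exd sd.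
have ex : short_exact i (res_aug Q) by split=> //; apply: res_aug_surj.
exact: (van _ _ _ _ ex (@res_projective _ _ Q 0) Q' f fd).
Qed.

(* Vanishing is required on all stable retracts, a class that, unlike T alone,
   is stable under passage to kernels of arbitrary projective covers. *)
Definition stable_ext_vanishes n T N : Prop :=
  forall L, stable_retract L T -> ext_vanishes n.+1 L N.

Lemma stable_ext_vanishes0 T N : ext1 T N -> stable_ext_vanishes 0 T N.
Proof. by move=> ext L LT; apply/ext_vanishes1/(ext1_stable_retract LT). Qed.

Lemma stable_ext_vanishesS n T N K P (i : {linear K -> P}) (p : {linear P -> T}) :
  short_exact i p -> projective P -> stable_ext_vanishes n K N ->
  stable_ext_vanishes n.+1 T N.
Proof.
move=> ip hP vK L LT; apply: ext_vanishes_kernel => K' P' i' p' ip' hP'.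
exact/vK/(stable_retract_kernel ip' hP' ip hP LT).
Qed.

End DimensionShift.

(** * Duality, reflexivity and the transpose *)

Section Duality.
Variable R : comNzRingType.
Implicit Types X Y P Q V W : lmodType R.
Local Notation "X ^*" := ({linear X -> R^o} : lmodType R).

Lemma dual_map_exists X Y (f : {linear X -> Y}) :
  exists f' : {linear Y^* -> X^*}, forall g x, f' g x = g (f x).
Proof.
have [|f' f'E] := @linear_map_of R (Y^*) (X^*) 
    (fun g => (g \o f : {linear X -> R^o})).
  by move=> a g h; apply: linear_ext.
by exists f' => g x; rewrite f'E.
Qed.

(** The two halves of reflexivity: injectivity of the evaluation map from X to its bidual here,
    surjectivity in [bidual_surjective]. *)
Definition torsionless X : Prop :=
  forall x : X, (forall f : {linear X -> R^o}, f x = 0) -> x = 0.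

Definition bidual_surjective X : Prop :=
  forall phi : {linear X^* -> R^o}, exists x, forall f, phi f = f x.

Lemma dual_basis P : fin_gen P -> projective P ->
  exists n (g : 'I_n -> P) (c : 'I_n -> {linear P -> R^o}),
    forall x, x = \sum_i c i x *: g i.
Proof.
move=> /free_cover[n [p sp]] hP; have [s sE] := hP _ _ p idfun sp.
have /choice[c cE] (i : 'I_n) : exists c : {linear P -> R^o},
    forall x, c x = s x 0 i.
  by apply: linear_map_of => a x y; rewrite linearP !mxE.
exists n, (fun i => p (delta_mx 0 i)), c => x.
rewrite -[LHS]sE [s x]row_sum_delta linear_sum; apply: eq_bigr => i _.
by rewrite linearZ cE.
Qed.

Lemma projective_torsionless P : fin_gen P -> projective P -> torsionless P.
Proof.
move=> fP /(dual_basis fP)[n [g [c cE]]] x x0.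
by rewrite (cE x) big1 // => i _; rewrite x0 scale0r.
Qed.

Lemma dual_basis_dual P n (g : 'I_n -> P) (c : 'I_n -> {linear P -> R^o}) :
  (forall x, x = \sum_i c i x *: g i) ->
  forall f : {linear P -> R^o}, f = \sum_i (f (g i) : R) *: c i.
Proof.
move=> cE f; apply: linear_ext => x.
have -> : (\sum_i (f (g i) : R) *: c i) x = \sum_i (f (g i) : R) *: (c i x).
  by elim/big_rec2: _ => // i u v _ <-.
rewrite {1}(cE x) linear_sum; apply: eq_bigr => i _.
by rewrite linearZ; apply: mulrC.
Qed.

Lemma projective_bidual P : fin_gen P -> projective P -> bidual_surjective P.
Proof.
move=> fP /(dual_basis fP)[n [g [c /dual_basis_dual cE]]] phi.
exists (\sum_i (phi (c i) : R) *: g i) => f.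
rewrite {1}(cE f) !linear_sum; apply: eq_bigr => i _.
by rewrite !linearZ; apply: mulrC.
Qed.

Lemma projective_dual P : fin_gen P -> projective P -> projective (P^*).
Proof.
move=> fP /(dual_basis fP)[n [g [c /dual_basis_dual cE]]] M N p f sp.
have [u uE] : exists u : {linear P^* -> 'rV[R]_n},
    forall h, u h = \row_i h (g i).
  by apply: linear_map_of => a h k; apply/rowP => i; rewrite !mxE.
have [v vE] := @free_map R n (P^*) c.
have [h hE] := @projective_rV R n _ _ p (f \o v) sp.
exists (h \o u) => x; rewrite /= hE /= vE uE; congr (f _).
by rewrite [RHS]cE; apply: eq_bigr => i _; rewrite mxE.
Qed.

Section Coresolved.
Variable C : lmodType R -> Prop.
Hypothesis C_ext1 : forall V, C V -> ext1 V R^o.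
Hypothesis C_cosyzygy : forall V, C V ->
  exists (Q W : lmodType R) (j : {linear V -> Q}) (q : {linear Q -> W}),
    [/\ fin_gen Q, projective Q, C W & short_exact j q].

Lemma coresolved_torsionless V : C V -> torsionless V.
Proof.
move=> /C_cosyzygy[Q [W [j [q [fQ hQ _ [inj_j _ _]]]]]] x x0.
apply: inj_j; rewrite linear0; apply: (projective_torsionless fQ hQ) => f.
exact: (x0 (f \o j)).
Qed.

Lemma dual_short_exact V Q W (j : {linear V -> Q}) (q : {linear Q -> W})
    (j' : {linear Q^* -> V^*}) (q' : {linear W^* -> Q^*}) :
  (forall g x, j' g x = g (j x)) -> (forall g x, q' g x = g (q x)) ->
  short_exact j q -> ext1 W R^o -> short_exact q' j'.
Proof.
move=> jE qE jq extW; have [inj_j exjq sq] := jq; split.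
- move=> f g e; apply: linear_ext => w; have [x <-] := sq w.
  by rewrite -!qE e.
- move=> f; split=> [f0|[g <-]].
    have [x|g gE] := descend_surjection (h := f) sq.
      by move=> /exjq[v <-]; rewrite -jE f0.
    by exists g; apply: linear_ext => x; rewrite qE gE.
  apply: linear_ext => x; rewrite jE qE.
  by rewrite (_ : q (j x) = 0) ?linear0 //; apply/exjq; exists x.
- move=> f; have [g gE] := extW _ _ _ _ jq f.
  by exists g; apply: linear_ext => x; rewrite jE gE.
Qed.

(** Pulled back to the dual of Q, phi is evaluation at some y. Functionals that come from W restrict
    to zero on V, so they all vanish at q y; W is torsionless, hence q y = 0 and y comes from V. *)
Lemma coresolved_bidual V : C V -> bidual_surjective V.
Proof.
move=> /C_cosyzygy[Q [W [j [q [fQ hQ CW jq]]]]] phi.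
have [j' j'E] := dual_map_exists j; have [q' q'E] := dual_map_exists q.
have [_ exd sd] := dual_short_exact j'E q'E jq (C_ext1 CW).
have [_ exjq _] := jq.
have [y yE] := projective_bidual fQ hQ (phi \o j').
have /exjq[x xE] : q y = 0.
  apply: (coresolved_torsionless CW) => f.
  rewrite -q'E -yE /= (_ : j' (q' f) = 0) ?linear0 //.
  by apply/exd; exists f.
by exists x => f; have [g <-] := sd f; rewrite -[LHS]/((phi \o j') g) yE j'E xE.
Qed.

(** The dual of W is a syzygy of the dual of V, and W is again in [C], so each cosyzygy lowers the
    degree by one. In the lowest degree a functional on the dual of W is evaluation at a point w = q
    y, and evaluation at y extends it to the dual of Q. *)
Lemma coresolved_dual_vanishes n V : C V -> stable_ext_vanishes n (V^*) R^o.
Proof.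
elim: n V => [|n IHn] V CV; have [Q [W [j [q [fQ hQ CW jq]]]]] := C_cosyzygy CV;
  have [j' j'E] := dual_map_exists j; have [q' q'E] := dual_map_exists q;
  have dex := dual_short_exact j'E q'E jq (C_ext1 CW);
  have hQ' := projective_dual fQ hQ; last exact: stable_ext_vanishesS dex hQ' (IHn _ CW).
apply/stable_ext_vanishes0/(ext1_cover dex hQ') => phi.
have [w wE] := coresolved_bidual CW phi.
have [_ _ sq] := jq; have [y yE] := sq w.
have [ev evE] : exists ev : {linear Q^* -> R^o}, forall f, ev f = f y.
  by apply: linear_map_of.
by exists ev => f; rewrite evE q'E yE wE.
Qed.

(* The transpose has the projective resolution
   0 <- Tr V <- P_1^* <- P_0^* <- Q_0^* <- Q_1^* <- ..., where the Q_i come from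
   iterated cosyzygies of V; its dual is exact by reflexivity. *)
Lemma coresolved_transpose_vanishes n V (p : proj_presentation V) :
  C V -> stable_ext_vanishes n (transpose p) R^o.
Proof.
move=> CV.
have exp := @pres_exact _ _ p; have sp := @pres_aug_surj _ _ p.
have f0 := @pres_fg0 _ _ p; have h0 := @pres_projective0 _ _ p.
have f1 := @pres_fg1 _ _ p; have h1 := @pres_projective1 _ _ p.
have [d dE] := dual_map_exists (pres_d p).
have [e eE] := dual_map_exists (pres_aug p).
have [|t tE] := @linear_map_of R ((pres_1 p)^*) (transpose p)
    (@lmod_pi _ _ _ (dual_image_submod p)).
  by move=> a x y; rewrite lmod_piD -(lmod_quot_scaleE (dual_image_submod p)).
have st : surjective t by move=> z; have [f <-] := lmod_pi_surj z; exists f.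
have td : exact_at d t.
  move=> f; rewrite -(linear0 t) !tE lmod_pi_eq subr0.
  split=> [/asboolP[g gE]|[g <-]].
    by exists g; apply: linear_ext => x; rewrite dE gE.
  by apply/asboolP; exists g => x; rewrite dE.
have [K [i [inj_i iE]]] := kernel_exists t.
have [f|d' d'E] := lift_injection (h := d) inj_i.
  by apply/iE/td; exists f.
have sd' : surjective d'.
  move=> k; have /td[f fE] : t (i k) = 0 by apply/iE; exists k.
  by exists f; apply: inj_i; rewrite d'E.
have ed : short_exact e d'.
  split=> //.
  - move=> f g fg; apply: linear_ext => v; have [x <-] := sp v.
    by rewrite -!eE fg.
  - move=> f; split=> [f0'|[g <-]].
      have [x|g gE] := descend_surjection (h := f) sp.
        by move=> /exp[y <-]; rewrite -dE -d'E f0' linear0.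
      by exists g; apply: linear_ext => x; rewrite eE gE.
    apply: inj_i; rewrite d'E linear0; apply: linear_ext => x; rewrite dE eE.
    by rewrite (_ : pres_aug p _ = 0) ?linear0 //; apply/exp; exists x.
have it : short_exact i t by split.
have hd0 := projective_dual f0 h0; have hd1 := projective_dual f1 h1.
have ev P (y : P) : exists ev : {linear P^* -> R^o}, forall f, ev f = f y.
  by apply: linear_map_of.
(* Index n stands for degree n + 1. The first two cases are the ends of Auslander's sequence 0 ->
   Ext^1(Tr V, R) -> V -> V^** -> Ext^2(Tr V, R) -> 0: degree 1 vanishes because V is torsionless,
   degree 2 because V maps onto its bidual. From degree 3 on, the shift by two syzygies reduces to
   the dual of V. *)
case: n => [|[|n]].
- apply/stable_ext_vanishes0/(ext1_cover it hd1) => phi.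
  have [y yE] := projective_bidual f0 h0 (phi \o d').
  have /exp[x xE] : pres_aug p y = 0.
    apply: (coresolved_torsionless CV) => f; rewrite -eE -yE /=.
    rewrite (_ : d' (e f) = 0) ?linear0 //.
    by have [_ ed' _] := ed; apply/ed'; exists f.
  have [g gE] := ev _ x; exists g => k; have [f <-] := sd' k.
  by rewrite d'E gE dE xE -yE.
- apply: (stable_ext_vanishesS it hd1).
  apply/stable_ext_vanishes0/(ext1_cover ed hd0) => phi.
  have [v vE] := coresolved_bidual CV phi; have [y yE] := sp v.
  have [g gE] := ev _ y; exists g => f.
  by rewrite gE eE yE vE.
- apply: (stable_ext_vanishesS it hd1); apply: (stable_ext_vanishesS ed hd0).
  exact: coresolved_dual_vanishes.
Qed.

End Coresolved.

End Duality.

Theorem theorem5p5 (R : comNzRingType) (C : lmodType R -> Prop)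
    (R_noetherian : noetherian R) (R_henselian : henselian_local_ring R)
    (C_subcategory : subcategory C)
    (C_resolving : resolving C)
    (C_sub_H : forall X : lmodType R, C X -> in_H X)
    (C_finite_type : finite_type C) :
  frobenius (mod_category (stable_category C)) /\
  (forall X : lmodType R, C X -> in_G X).
Proof.
have C_ext1 V : C V -> ext1 V R^o.
  by move=> /C_sub_H[fV van]; apply: ext1_of_vanishing => //; apply: van.
have [M M_generator] := additive_generator_exists R_noetherian C_subcategory
  C_finite_type.
have C_cosyzygy := cosyzygy_exists R_noetherian C_subcategory C_resolving C_ext1
  M_generator.
split.
  apply: mod_frobenius.
  - exact: stable_zero.
  - exact: stable_biproduct.
  - exact: stable_weak_kernel.
  - exact: cosyzygy_is_weak_kernel.
move=> X CX; have [fX van] := C_sub_H X CX; split=> // p [//|n] _.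
have v := @coresolved_transpose_vanishes _ _ C_ext1 C_cosyzygy n X p CX.
exact/v/stable_retract_refl.
Qed.
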